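(* There exists $n_0$ such that the following holds for every finite abelian group $G$ of even order $n\geq n_0$, every $A\subseteq G$, and every container family $\mathcal{F}$ of $A$ together with any fixed assignment defining the sets $\Phi(F_1,\dots,F_5)$ (see context). (a) If $B$ is the unique largest sum-free set of $G$ and $\kappa_5(A)>4.999^{n/2}$, then $|A\setminus B|<15n(\log n)^{-1/27}$. (b) If $G$ has at least two largest sum-free sets and $(F_1,\dots,F_5)\in\mathcal{F}^5$ satisfies $|\Phi(F_1,\dots,F_5)|>5.9^{n/2}$, then there are largest sum-free sets $B_1,B_2,B_3$ of $G$ such that one of the following holds: 1. $B_3=B_1\triangle B_2$ and there is a function $f:\{1,\dots,5\}\to\{1,2,3\}$ such that $|F_i\setminus B_{f(i)}|<3n(\log n)^{-1/27}$ for all $i\in\{1,\dots,5\}$ and $(B_{f(1)},\dots,B_{f(5)})$ consists of one $4$-atom and two $3$-atoms; 2. there are four distinct largest sum-free sets $B_4,\dots,B_7$ contained in $B_1\cup B_2\cup B_3$ and a function $f:\{1,\dots,5\}\to\{1,\dots,7\}$ such that $|F_i\setminus B_{f(i)}|<3n(\log n)^{-1/27}$ for all $i\in\{1,\dots,5\}$ and $(B_{f(1)},\dots,B_{f(5)})$ consists of two $2$-atoms, four $3$-atoms and one $4$-atom.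
   Context: Let $G$ be a finite abelian group of order $n$. A set is sum-free if it contains no (not necessarily distinct) $a,b,c$ with $a+b=c$ (a Schur triple); a largest sum-free set is a sum-free set of maximum size. For $A\subseteq G$, $\Phi_r(A)$ is the set of sum-free $r$-colorings of $A$, i.e. maps $\varphi:A\to\{1,\dots,r\}$ with every $\varphi^{-1}(i)$ sum-free, and $\kappa_r(A)=|\Phi_r(A)|$. A container family of $A$ is a family $\mathcal{F}$ of subsets of $A$ such that (1) $\log_2|\mathcal{F}|\leq n(\log n)^{-1/18}$; (2) every sum-free set $I\subseteq A$ is contained in some $F\in\mathcal{F}$; (3) every $F\in\mathcal{F}$ contains at most $n^2(\log n)^{-1/9}$ Schur triples. Given such $\mathcal{F}$, fix an assignment that maps each $\varphi\in\Phi_r(A)$ to a tuple $(F_1,\dots,F_r)\in\mathcal{F}^r$ with $\varphi^{-1}(i)\subseteq F_i$ for all $i$; $\Phi(F_1,\dots,F_r)$ denotes the set of $\varphi\in\Phi_r(A)$ assigned to $(F_1,\dots,F_r)$. For a largest sum-free set $B$ write $B^1=B$, $B^0=G\setminus B$. For a tuple $\mathcal{B}=(B_1,\dots,B_t)$ of largest sum-free sets and $\boldsymbol{\varepsilon}\in\{0,1\}^t$, the atom $\mathcal{B}(\boldsymbol{\varepsilon})=\bigcap_{i=1}^t B_i^{\varepsilon_i}$ is a $k$-atom if $\sum_i\varepsilon_i=k$. The tuple $\mathcal{B}$ consists of a given collection of atoms if these atoms (nonempty) partition $\bigcup_i B_i$. *)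

(* Defs.v *)
From mathcomp Require Import all_boot all_order all_algebra.
From mathcomp Require Import reals exp.

Set Implicit Arguments.
Unset Strict Implicit.
Unset Printing Implicit Defensive.

Import Order.TTheory GRing.Theory Num.Theory.
Local Open Scope ring_scope.

Section SumFree.
Variable G : finZmodType.
Implicit Types (A B : {set G}) (FF : {set {set G}}).

(* Schur triples are counted as ordered triples (a, b, c). *)
Definition schur_triples A : {set G * G * G} :=
  [set t : G * G * G | [&& t.1.1 \in A, t.1.2 \in A, t.2 \in A
                         & t.1.1 + t.1.2 == t.2]].

Definition sum_free A : bool := schur_triples A == set0.

Definition largest_sum_free B : bool :=
  sum_free B && [forall C : {set G}, sum_free C ==> (#|C| <= #|B|)%N].

Definition symdiff A B : {set G} := (A :\: B) :|: (B :\: A).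

Definition coloring r A := {ffun {x : G | x \in A} -> 'I_r}.

Definition color_class r A (phi : coloring r A) (i : 'I_r) : {set G} :=
  [set val x | x in [set x : {x : G | x \in A} | phi x == i]].

Definition sum_free_colorings r A : {set coloring r A} :=
  [set phi : coloring r A | [forall i, sum_free (color_class phi i)]].

Definition kappa r A : nat := #|sum_free_colorings r A|.

Definition container_family (R : realType) A FF : Prop :=
  let n : R := #|G|%:R in
  [/\ FF \subset powerset A,
      ln #|FF|%:R / ln 2 <= n * ln n `^ (- (1 / 18)),
      forall I : {set G}, I \subset A -> sum_free I ->
        exists2 F, F \in FF & I \subset F
    & forall F, F \in FF ->
        #|schur_triples F|%:R <= n ^+ 2 * ln n `^ (- (1 / 9))].

(* Only the values of g on sum-free colorings are constrained or used. *)
Definition container_assignment r A FF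
    (g : coloring r A -> r.-tuple {set G}) : Prop :=
  forall phi, phi \in sum_free_colorings r A ->
  forall i, tnth (g phi) i \in FF /\ color_class phi i \subset tnth (g phi) i.

Definition assigned_colorings r A (g : coloring r A -> r.-tuple {set G})
    (Fs : r.-tuple {set G}) : {set coloring r A} :=
  [set phi in sum_free_colorings r A | g phi == Fs].

Definition atom t (Bs : t.-tuple {set G}) (e : t.-tuple bool) : {set G} :=
  \bigcap_(i < t) (if tnth e i then tnth Bs i else ~: tnth Bs i).

Definition atom_level t (e : t.-tuple bool) : nat := \sum_(i < t) tnth e i.

(* [consists_of Bs ks]: Bs consists of a collection of atoms whose levels,
   listed with multiplicity, are ks.  [partition] requires nonempty blocks, and
   atoms with distinct indices are disjoint, so distinct e in E give distinct
   blocks and counting indices is counting atoms. *)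
Definition consists_of t (Bs : t.-tuple {set G}) (ks : seq nat) : bool :=
  [exists E : {set t.-tuple bool},
    partition [set atom Bs e | e in E] (\bigcup_(i < t) tnth Bs i)
    && perm_eq [seq atom_level e | e <- enum E] ks].

End SumFree.

(* Main.v *)
(** Containers F_i have few Schur triples, so discarding the few elements that
lie in many of them leaves a set F with |F ∩ (F + a)| <= e for every a in F.
If moreover |F| > (2/5)n + e, then any p in F - F satisfies
|F ∩ (F + p)| >= 3|F| - 2e - n, so for p, q in F - F the overlap of F with
F + (p + q) is at least 5|F| - 4e - 2n > 0 and p + q is again in F - F.  Hence
F - F is a subgroup, disjoint from F, of index 2, and F lies in its complement,
a largest sum-free set.

Up to subexponential factors the number of colorings assigned to (F_1,...,F_5)
is at most the product over x of the number of i with x in F_i.  For five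
complements of index-2 subgroups this product depends only on the linear
dependencies between their characters over the two-element field, which leaves
finitely many cases.  A cleaned container in no such complement has size at most
about 2n/5; counting multiplicities d through d <= 3^(d/3), and for (a) through
a finer split of F along B, excludes it. *)

Require Import Defs.
From Stdlib Require Import NArith.
From mathcomp Require Import all_boot all_order all_algebra.
From mathcomp Require Import reals sequences exp.
From mathcomp Require Import zify ring lra.

Set Implicit Arguments.
Unset Strict Implicit.
Unset Printing Implicit Defensive.

Import Order.TTheory GRing.Theory Num.Theory.
Local Open Scope ring_scope.

(** * Cleaned sets and subgroups of index two *)

Section Stability.
Variable G : finZmodType.
Implicit Types (A B C F H K P Q T : {set G}) (a b c d s x y : G).

Definition shift F d : {set G} := [set x | x - d \in F].

Definition overlap F d : nat := #|F :&: shift F d|.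

(** For [b] in [F], [overlap F b] counts the Schur triples [(x - b, b, x)] in [F]. Cleaning thus
    discards the middle entries of more than [e] triples. *)
Definition clean (e : nat) F : {set G} := [set b in F | (overlap F b <= e)%N].

Definition subgroup H : Prop := 0 \in H /\ {in H &, forall x y, x - y \in H}.

(* Nonempty odd sets are exactly the complements of subgroups of index 2. *)
Definition odd_set B : Prop :=
  forall x y, (x + y \in B) = (x \in B) (+) (y \in B).

Lemma overlap_mono F F' d : F \subset F' -> (overlap F d <= overlap F' d)%N.
Proof.
move=> /subsetP sF; apply/subset_leq_card/subsetP=> x; rewrite !inE.
by case/andP=> /sF -> /sF ->.
Qed.

Lemma clean_sub e F : clean e F \subset F.
Proof. by apply/subsetP=> x; rewrite inE; case/andP. Qed.

Lemma clean_overlap e F : {in clean e F, forall a, overlap (clean e F) a <= e}%N.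
Proof.
move=> a; rewrite inE => /andP[_]; apply: leq_trans.
exact/overlap_mono/clean_sub.
Qed.

Lemma sum_overlap F : (\sum_(b in F) overlap F b <= #|schur_triples F|)%N.
Proof.
rewrite -sum1_card (partition_big (fun t : G * G * G => t.1.2) (mem F)) /=; last first.
  by move=> t; rewrite inE => /and4P[].
apply: leq_sum => b bF; rewrite sum1dep_card.
have inj : injective (fun x => (x - b, b, x)) by move=> x y [].
rewrite /overlap -(card_imset _ inj).
apply/subset_leq_card/subsetP=> t /imsetP[x].
by rewrite !inE => /andP[xF xbF] -> /=; rewrite xF xbF bF subrK !eqxx.
Qed.

(** Markov's inequality: each discarded element is the middle entry of at least [e + 1] Schur
    triples. *)
Lemma card_clean e F : (e.+1 * #|F :\: clean e F| <= #|schur_triples F|)%N.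
Proof.
apply: leq_trans (sum_overlap F).
rewrite (bigID (fun b => b \in clean e F)) /=.
apply: leq_trans (leq_addl _ _).
rewrite mulnC -sum_nat_const.
rewrite [leqLHS](eq_bigl (fun b => (b \in F) && (b \notin clean e F))); last first.
  by move=> b; rewrite !inE andbC.
by apply: leq_sum => b; rewrite !inE => /andP[->]; rewrite /= -ltnNge.
Qed.

Lemma card_shift B d : #|shift B d| = #|B|.
Proof.
have -> : shift B d = [set y + d | y in B].
  apply/setP=> x; rewrite inE; apply/idP/imsetP => [xB|[y yB ->]].
    by exists (x - d); rewrite ?subrK.
  by rewrite addrK.
by rewrite card_imset //; exact: addIr.
Qed.

Lemma card_setI_ge P Q T : P \subset T -> Q \subset T ->
  (#|P| + #|Q| <= #|P :&: Q| + #|T|)%N.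
Proof.
move=> sP sQ; have := cardsUI P Q.
have : (#|P :|: Q| <= #|T|)%N by apply: subset_leq_card; rewrite subUset sP.
lia.
Qed.

(** [P + s] and [Q] both lie in [T], and their common points lie in both [F] and [F + s]. *)
Lemma overlap_pack F P Q T s : P \subset F -> Q \subset F -> Q \subset T ->
  {in P, forall x, x + s \in T} -> (#|P| + #|Q| <= #|T| + overlap F s)%N.
Proof.
move=> /subsetP sP /subsetP sQ QT PT; rewrite -(card_shift P s).
have sPT : shift P s \subset T.
  by apply/subsetP=> x; rewrite inE => /PT; rewrite subrK.
have := card_setI_ge sPT QT.
have : (#|shift P s :&: Q| <= overlap F s)%N.
  apply/subset_leq_card/subsetP=> x; rewrite !inE.
  by case/andP=> /sP -> /sQ ->.
lia.
Qed.

Lemma subgroupN H x : subgroup H -> x \in H -> - x \in H.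
Proof. by case=> H0 Hs xH; rewrite -sub0r Hs. Qed.

Lemma subgroupD H x y : subgroup H -> x \in H -> y \in H -> x + y \in H.
Proof. by move=> gH xH yH; rewrite -[y]opprK; apply: gH.2 => //; apply: subgroupN. Qed.

Section TwoFifths.
Variables (H F : {set G}) (e : nat).
Hypotheses (gH : subgroup H) (FH : F \subset H).
Hypothesis ovF : {in F, forall a, overlap F a <= e}%N.
Hypothesis bigF : (2 * #|H| + 5 * e < 5 * #|F|)%N.

Let K : {set G} := [set z.1 - z.2 | z in setX F F].

Let KP z : reflect (exists a b, [/\ a \in F, b \in F & z = a - b]) (z \in K).
Proof.
apply: (iffP imsetP) => [[[a b] /setXP[/= aF bF] ->]|[a [b [aF bF ->]]]].
  by exists a, b.
by exists (a, b) => //; apply/setXP.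
Qed.

(** For [c] in [F], at least [#|F| - e] points of [F + c] fall in [H :\: F]. The sets obtained for
    [a] and [b] share at least [2(#|F| - e) - (#|H| - #|F|)] points, and translating these by [-b]
    puts them in [F] and in [F + (a - b)]. *)
Let overlap_diff a b : a \in F -> b \in F ->
  (3 * #|F| <= overlap F (a - b)%R + 2 * e + #|H|)%N.
Proof.
move=> aF bF.
have sub c : c \in F -> shift F c \subset H.
  move=> cF; apply/subsetP=> x; rewrite inE => /(subsetP FH) xH.
  by rewrite -(subrK c x); apply: subgroupD => //; apply: (subsetP FH).
pose S c := shift F c :\: F.
have cS c : c \in F -> (#|F| <= #|S c| + e)%N.
  move=> cF; rewrite -(card_shift F c) -(cardsID F).
  rewrite addnC leq_add2l; apply: leq_trans (ovF cF).
  by apply: subset_leq_card; apply/subsetP=> x; rewrite !inE andbC.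
have sS c : c \in F -> S c \subset H :\: F by move=> cF; apply: setSD; exact: sub.
have := card_setI_ge (sS a aF) (sS b bF).
have : (#|S a :&: S b| <= overlap F (a - b)%R)%N.
  rewrite /overlap -(card_shift (S a :&: S b) (- b)).
  apply/subset_leq_card/subsetP=> x.
  rewrite !inE opprK addrK => /andP[/andP[_ xa] /andP[_ ->]] /=.
  by rewrite opprB addrA.
have := cS a aF; have := cS b bF; have := cardsD H F.
have /setIidPr -> := FH.
have := subset_leq_card FH; lia.
Qed.

Let K_add p q : p \in K -> q \in K -> p + q \in K.
Proof.
move=> /KP[a [b [aF bF pab]]] /KP[c [d [cF dF qcd]]].
have hp := overlap_diff aF bF; have hq := overlap_diff cF dF.
rewrite -pab in hp; rewrite -qcd in hq.
(* Both sets lie in [F + p], which has [#|F|] points, and their sizes add up to more. A common point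
   [x] has [x] and [x - p - q] in [F]. *)
pose P := F :&: shift F p; pose Q := shift (F :&: shift F q) p.
have cQ : #|Q| = overlap F q.
  exact: card_shift.
have sP : P \subset shift F p by apply/subsetP=> x; rewrite !inE => /andP[].
have sQ : Q \subset shift F p by apply/subsetP=> x; rewrite !inE => /andP[].
have := card_setI_ge sP sQ; rewrite card_shift cQ.
have -> : #|P| = overlap F p by [].
move=> h; have : (0 < #|P :&: Q|)%N by move: h hp hq bigF; lia.
case/card_gt0P=> x; rewrite !inE => /andP[/andP[xF _] /andP[_ xF2]].
apply/KP; exists x, (x - p - q); split=> //.
by rewrite -addrA -opprD subKr.
Qed.

Let F_gt0 : exists a, a \in F.
Proof. by apply/card_gt0P; move: bigF; lia. Qed.

(* F - F is the subgroup: above density 2/5 the overlap with a sum of two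
   differences is still positive, so F - F is closed under addition. *)
Lemma two_fifths : exists K, [/\ subgroup K, K \subset H, [disjoint F & K]
  & {in H :\: K &, forall x y, x + y \in K}].
Proof.
have gK : subgroup K.
  split; first by have [a aF] := F_gt0; apply/KP; exists a, a; rewrite subrr.
  move=> x y xK /KP[a [b [aF bF ->]]]; rewrite opprB; apply: K_add => //.
  by apply/KP; exists b, a.
have KH : K \subset H.
  by apply/subsetP=> x /KP[a [b [aF bF ->]]]; apply: gH.2; apply: (subsetP FH).
have [a aF] := F_gt0.
have leFK : (#|F| <= #|K|)%N.
  rewrite -(card_shift F (- a)); apply/subset_leq_card/subsetP=> x.
  by rewrite inE opprK => xF; apply/KP; exists (x + a), a; rewrite addrK; split.
exists K; split=> //.
  (* An element of [F] has overlap at most [e], a difference has overlap at least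
     [3#|F| - 2e - #|H|], which exceeds [e]. *)
  rewrite -setI_eq0; apply/eqP/setP=> x; rewrite in_set0 in_setI; apply/negP.
  case/andP=> xF /KP[b [c [bF cF xbc]]].
  have := ovF xF; have := overlap_diff bF cF; rewrite -xbc.
  move: bigF; have := subset_leq_card FH; lia.
move=> x y; rewrite !in_setD => /andP[xK xH] /andP[yK yH].
(* If [x + y] is outside [K], then [K + x] and [K - y] are disjoint subsets of [H :\: K], so
   [3#|K| <= #|H|]; but [#|K| >= #|F|] exceeds two fifths of [#|H|]. *)
apply/negPn/negP=> xyK.
have hx : shift K x \subset H :\: K.
  apply/subsetP=> z; rewrite !inE => zK; apply/andP; split.
    apply: contra xK => zK'; rewrite -(subKr z x).
    exact: gK.2.
  by rewrite -(subrK x z) subgroupD // (subsetP KH).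
have hy : shift K (- y) \subset H :\: K.
  apply/subsetP=> z; rewrite !inE opprK => zK; apply/andP; split.
    by apply: contra yK => zK'; rewrite -(addKr z y) addrC; apply: gK.2.
  by rewrite -(addrK y z); apply: gH.2 => //; apply: (subsetP KH).
have := card_setI_ge hx hy; rewrite !card_shift.
have -> : shift K x :&: shift K (- y) = set0.
  apply/setP=> z; rewrite !inE opprK; apply/negP => /andP[zx zy].
  case/negP: xyK; rewrite (_ : x + y = z + y - (z - x)); first exact: gK.2.
  by rewrite opprB [RHS]addrC [RHS]addrA subrK.
rewrite cards0 cardsD; have /setIidPr -> := KH.
have := subset_leq_card KH; move: bigF leFK; lia.
Qed.

End TwoFifths.

Lemma odd_set0 B : odd_set B -> (0 \in B) = false.
Proof. by move=> oB; rewrite -[0]addr0 oB addbb. Qed.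

Lemma odd_setN B x : odd_set B -> (- x \in B) = (x \in B).
Proof.
by move=> oB; have := oB (- x) x; rewrite addNr odd_set0 //; do 2 case: (_ \in B).
Qed.

Lemma odd_setB B x y : odd_set B -> (x - y \in B) = (x \in B) (+) (y \in B).
Proof. by move=> oB; rewrite oB odd_setN. Qed.

Lemma odd_set_symdiff B C : odd_set B -> odd_set C -> odd_set (symdiff B C).
Proof.
move=> oB oC x y; rewrite !inE oB oC.
by case: (x \in B); case: (y \in B); case: (x \in C); case: (y \in C).
Qed.

Lemma odd_set_compl B : odd_set B -> subgroup (~: B).
Proof.
move=> oB; split; first by rewrite inE odd_set0.
by move=> x y; rewrite !inE odd_setB // => /negbTE-> /negbTE->.
Qed.

Lemma card_odd_compl B : odd_set B -> B != set0 -> #|~: B| = #|B|.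
Proof.
move=> oB /set0Pn[c cB]; rewrite -(card_shift B c); apply: eq_card => x.
by rewrite !inE odd_setB // cB addbT.
Qed.

Lemma card_odd_set B : odd_set B -> B != set0 -> (2 * #|B| = #|G|)%N.
Proof. by move=> oB B0; rewrite -(cardsC B) card_odd_compl // mul2n addnn. Qed.

Lemma sum_freeP C : reflect {in C &, forall x y, x + y \notin C} (sum_free C).
Proof.
apply: (iffP eqP) => [C0 x y xC yC|sC].
  apply/negP => xyC; have := in_set0 (x, y, x + y).
  by rewrite -C0 inE /= xC yC xyC eqxx.
apply/setP=> -[[x y] z]; rewrite !inE /=; apply/negP => /and4P[xC yC zC /eqP xyz].
by have := sC x y xC yC; rewrite xyz zC.
Qed.

Lemma card_sum_free C : sum_free C -> (2 * #|C| <= #|G|)%N.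
Proof.
move=> /sum_freeP sC; have [->|[c cC]] := set_0Vmem C; first by rewrite cards0.
have sub : shift C c \subset ~: C.
  apply/subsetP=> x; rewrite !inE => xc; apply/negP => xC.
  by have := sC _ _ xc cC; rewrite subrK xC.
by have := subset_leq_card sub; rewrite card_shift -(cardsC C); lia.
Qed.

Lemma odd_set_largest B : odd_set B -> B != set0 -> largest_sum_free B.
Proof.
move=> oB B0; apply/andP; split.
  by apply/sum_freeP => x y xB yB; rewrite oB xB yB.
apply/forallP=> C; apply/implyP=> /card_sum_free.
rewrite -(card_odd_set oB B0); lia.
Qed.

Lemma large_clean_odd F e : {in F, forall a, overlap F a <= e}%N ->
  (2 * #|G| + 5 * e < 5 * #|F|)%N ->
  exists B, [/\ odd_set B, B != set0 & F \subset B].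
Proof.
rewrite -cardsT => ovF bigF.
have gT : subgroup [set: G] by split=> [|x y _ _]; rewrite inE.
have [K [gK _ dFK K2]] := two_fifths gT (subsetT F) ovF bigF.
have FK : F \subset ~: K by rewrite -disjoints_subset.
have [a aF] : exists a, a \in F by apply/card_gt0P; move: bigF; lia.
exists (~: K); split=> //; last by apply/set0Pn; exists a; apply: (subsetP FK).
have addK x y : x \in K -> (x + y \in K) = (y \in K).
  move=> xK; apply/idP/idP => [xyK|]; last exact: subgroupD.
  by rewrite -(addKr x y) addrC; apply: gK.2.
move=> x y; rewrite !inE.
have [xK|xK] := boolP (x \in K); first by rewrite addK.
have [yK|yK] := boolP (y \in K); first by rewrite addrC addK // xK.
by rewrite K2 ?inE ?xK ?yK.
Qed.

Section UniqueOdd.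
Variables (B F : {set G}) (e : nat).
Hypotheses (oB : odd_set B) (B0 : B != set0).
Hypothesis uniqB : forall C, odd_set C -> C != set0 -> C = B.
Hypothesis ovF : {in F, forall a, overlap F a <= e}%N.
Hypothesis FB : ~~ (F \subset B).

Lemma far_card : (5 * #|F| <= 2 * #|G| + 5 * e)%N.
Proof.
rewrite leqNgt; apply/negP => bigF; have [C [oC C0 FC]] := large_clean_odd ovF bigF.
by move: FB; rewrite -(uniqB oC C0) FC.
Qed.

(* A large part of F outside B is a coset of a subgroup K of index 4; as B is
   the only odd set, the quotient by K is cyclic, which leaves little room for
   F in the two cosets of K inside B. *)
Lemma far_split : (5 * #|F :\: B| <= #|G| + 5 * e)%N \/
  (4 * #|F :\: B| <= #|G|)%N /\ (10 * #|F :&: B| <= #|G|)%N.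
Proof.
set F0 := F :\: B; set F1 := F :&: B.
case: (leqP (5 * #|F0|) (#|G| + 5 * e)) => [|bigF0]; first by left.
right; pose H := ~: B.
have cH : (2 * #|H| = #|G|)%N by rewrite card_odd_compl ?card_odd_set.
have gH : subgroup H := odd_set_compl oB.
have F0H : F0 \subset H by apply/subsetP=> x; rewrite !inE => /andP[].
have ovF0 : {in F0, forall a, overlap F0 a <= e}%N.
  move=> a; rewrite inE => /andP[_ aF]; apply: leq_trans (ovF aF).
  exact/overlap_mono/subsetDl.
have bigF0' : (2 * #|H| + 5 * e < 5 * #|F0|)%N by rewrite cH.
(* Inside [H] the density threshold is halved, since [2 * #|H| = #|G|]. The resulting [K] has index
   2 in [H], and [F0] lies in the other coset [L]. *)
have [K [gK KH dF0K K2]] := two_fifths gH F0H ovF0 bigF0'.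
pose L := H :\: K.
have F0L : F0 \subset L by rewrite subsetD F0H.
have [f fF0] : exists f, f \in F0 by apply/card_gt0P; move: bigF0; clear; lia.
have fL := subsetP F0L f fF0.
have LH x : x \in L -> x \in H by rewrite in_setD => /andP[].
have KH' x : x \in K -> x \in H := subsetP KH x.
have addK x y : x \in K -> (x + y \in K) = (y \in K).
  move=> xK; apply/idP/idP => [xyK|]; last exact: subgroupD.
  by rewrite -(addKr x y) addrC; apply: gK.2.
have LE x : x \in H -> (x \in L) = (x \notin K) by move=> xH; rewrite in_setD xH andbT.
have addH x y : x \in H -> y \in H -> (x + y \in L) = (x \in L) (+) (y \in L).
  move=> xH yH; rewrite !LE ?(subgroupD gH) //.
  have [xK|xK] := boolP (x \in K); first by rewrite addK.
  have [yK|yK] := boolP (y \in K); first by rewrite addrC addK // xK.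
  by rewrite K2 // !inE ?xK ?yK -?in_setC ?xH ?yH.
have cL : #|L| = #|K|.
  rewrite -(card_shift K f); apply: eq_card => x; rewrite [RHS]inE.
  have [xH|xH] := boolP (x \in H); last first.
    apply/idP/idP => [/LH xH2|xfK]; first by rewrite xH2 in xH.
    by case/negP: xH; rewrite -(subrK f x); apply: (subgroupD gH); [exact: KH'|exact: LH].
  have xfH : x - f \in H by apply: gH.2 => //; apply: LH.
  by rewrite -{1}(subrK f x) (addH _ _ xfH (LH _ fL)) fL addbT LE // negbK.
have cK : (4 * #|K| = #|G|)%N.
  have := cardsID K H; have /setIidPr -> := KH.
  rewrite -/L cL -cH; clear; lia.
have le0 : (#|F0| <= #|K|)%N by rewrite -cL subset_leq_card.
split; first by rewrite -cK leq_mul2l.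
have /set0Pn[c cB] := B0.
have HB x : (x \in H) = (x \notin B) by rewrite inE.
have xcH x : x \in B -> x - c \in H by move=> xB; rewrite HB odd_setB // xB cB.
(* This says that the quotient by [K] is cyclic of order 4, generated by [c]. Otherwise the
   character of [H] with kernel [K] extends to the whole group with value 0 at [c], which gives an
   odd set containing [f], hence different from [B]. *)
have ccL : c + c \in L.
  apply/negPn/negP => ccL.
  pose C := [set x | if x \in B then x - c \in L else x \in L].
  have CE x : (x \in C) = if x \in B then x - c \in L else x \in L by rewrite in_set.
  have oC : odd_set C.
    move=> x y; rewrite !CE oB.
    have [xB|xB] := boolP (x \in B); have [yB|yB] := boolP (y \in B) => /=.
    - rewrite (_ : x + y = (x - c) + (y - c) + (c + c)); last first.
        by rewrite addrACA !subrK.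
      have h : x - c + (y - c) \in H by apply: (subgroupD gH); apply: xcH.
      have h2 : c + c \in H by rewrite HB oB addbb.
      by rewrite (addH _ _ h h2) (negbTE ccL) addbF addH ?xcH.
    - by rewrite addrAC addH ?xcH // HB.
    - by rewrite -addrA addH ?xcH // HB.
    - by rewrite addH // HB.
  have fC : f \in C by rewrite CE; move: (LH _ fL); rewrite HB => /negbTE ->.
  have C0 : C != set0 by apply/set0Pn; exists f.
  have CB := uniqB oC C0.
  by move: (LH _ fL); rewrite HB -CB fC.
pose Fa := [set x in F1 | x - c \in K]; pose Fb := [set x in F1 | x - c \in L].
have cF1 : (#|F1| = #|Fa| + #|Fb|)%N.
  rewrite -(cardsID (shift K c) F1); congr (_ + _)%N; apply: eq_card => x.
    by rewrite !inE.
  rewrite [RHS]inE [LHS]inE andbC; have [/setIP[_ xB]|] //= := boolP (x \in F1).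
  by rewrite LE ?xcH // inE.
have FaF : Fa \subset F by apply/subsetP=> x; rewrite !inE => /andP[/andP[]].
have FbF : Fb \subset F by apply/subsetP=> x; rewrite !inE => /andP[/andP[]].
have F0F : F0 \subset F by apply: subsetDl.
have FaK x : x \in Fa -> x - c \in K by rewrite inE => /andP[].
have FbL x : x \in Fb -> x - c \in L by rewrite inE => /andP[].
have KL x : x \in K -> (x \in L) = false by move=> xK; rewrite LE ?xK ?KH'.
have addcc x s : (x + s) = (x - c) + (s - c) + (c + c).
  by rewrite addrACA !subrK.
(* If [s] is in [c + K], then [F0 + s] shares the coset [c + L] with [Fb], and [Fa + s] shares [L]
   with [F0]. If [s] is in [c + L], then [F0 + s] shares [c + K] with [Fa], and [Fb + s] shares [L]
   with [F0]. Either way [overlap_pack] gives the same two bounds. *)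
have both s : s \in F1 ->
    (#|F0| + #|Fa| <= #|K| + e)%N /\ (#|F0| + #|Fb| <= #|K| + e)%N.
  case/setIP=> sF sB; have ov := ovF sF; have sH := xcH s sB.
  have ccH := LH _ ccL.
  have F0H' x : x \in F0 -> x \in H by move/(subsetP F0H).
  have F0L' x : x \in F0 -> x \in L by move/(subsetP F0L).
  have [sK|sK] := boolP (s - c \in K).
    have h1 := @overlap_pack F F0 Fb (shift L c) s F0F FbF.
    have h2 := @overlap_pack F Fa F0 L s FaF F0F F0L.
    have {}h1 : (#|F0| + #|Fb| <= #|K| + overlap F s)%N.
      rewrite -cL -(card_shift L c); apply: h1.
        by apply/subsetP=> x /FbL xL; rewrite in_set.
      by move=> x xF0; rewrite in_set -addrA (addH _ _ (F0H' _ xF0) sH) (F0L' _ xF0) (KL _ sK).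
    have {}h2 : (#|Fa| + #|F0| <= #|L| + overlap F s)%N.
      apply: h2 => x /FaK xK; have xs := subgroupD gK xK sK.
      by rewrite addcc (addH _ _ (KH' _ xs) ccH) ccL (KL _ xs).
    move: h1 h2 ov; rewrite cL; clear; lia.
  have sL : s - c \in L by rewrite LE.
  have h1 := @overlap_pack F F0 Fa (shift K c) s F0F FaF.
  have h2 := @overlap_pack F Fb F0 L s FbF F0F F0L.
  have {}h1 : (#|F0| + #|Fa| <= #|K| + overlap F s)%N.
    rewrite -(card_shift K c); apply: h1.
      by apply/subsetP=> x /FaK xK; rewrite inE.
    move=> x xF0; rewrite in_set -addrA; apply: K2; [exact: F0L'|exact: sL].
  have {}h2 : (#|Fb| + #|F0| <= #|L| + overlap F s)%N.
    apply: h2 => x /FbL xL; have xs : x - c + (s - c) \in K by apply: K2.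
    by rewrite addcc (addH _ _ (KH' _ xs) ccH) ccL (KL _ xs).
  move: h1 h2 ov; rewrite cL; clear; lia.
have [F10|[s sF1]] := set_0Vmem F1; first by rewrite F10 cards0 muln0.
(* The bounds add up to [2#|F0| + #|F1| <= 2#|K| + 2e], where [2#|K|] is half the group and [#|F0|]
   exceeds a fifth of it by more than [e]; a tenth is left for [F1]. *)
have := both s sF1; rewrite cF1; move: bigF0 cK; clear; lia.
Qed.

End UniqueOdd.

End Stability.

(** * Configurations of index-two cosets *)

Fixpoint bdot (u t : seq bool) : bool :=
  match u, t with
  | a :: u', b :: t' => (a && b) (+) bdot u' t'
  | _, _ => false
  end.

Fixpoint bitvecs (k : nat) : seq (seq bool) :=
  if k is k'.+1 then
    [seq false :: v | v <- bitvecs k'] ++ [seq true :: v | v <- bitvecs k']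
  else [:: [::]].

(* All ways to write m nonzero vectors over F_2, up to change of basis: each
   entry is a dimension k together with coordinates, the newest basis vector
   being the first coordinate. *)
Fixpoint configs (m : nat) : seq (nat * seq (seq bool)) :=
  if m is m'.+1 then
    flatten [seq (c.1.+1, (true :: nseq c.1 false) :: map (cons false) c.2)
                 :: [seq (c.1, u :: c.2) | u <- bitvecs c.1 & has id u]
            | c <- configs m']
  else [:: (0%N, [::])].

(** One entry per point of the space, repetitions kept: every point stands for the same number of
    group elements. *)
Definition patterns (c : nat * seq (seq bool)) : seq (seq bool) :=
  [seq [seq bdot u t | u <- c.2] | t <- bitvecs c.1].

Definition levels c : seq nat := [seq count id v | v <- patterns c].

(** Binary naturals let [vm_compute] handle the large powers in [config_ok]. Level 0 is raised to 1
    because elements outside every set contribute no factor. *)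
Definition level_prod c : N :=
  foldr (fun l p => N.mul (N.max 1 (N.of_nat l)) p) 1%num (levels c).

(** [uniq] makes distinct points index distinct atoms, so the nonzero levels are those of the atoms,
    with multiplicity. *)
Definition special (k : nat) (ks : seq nat) c : bool :=
  [&& c.1 == k, uniq (patterns c) & perm_eq [seq l <- levels c | l != 0%N] ks].

(* 5.8 lies between 1080^(1/4), the largest normalized product of a
   non-special configuration, and the threshold 5.9; both special ones give 6. *)
Definition config_ok c : bool :=
  [|| N.leb (N.mul (N.pow 10 (N.pow 2 (N.of_nat c.1))) (N.pow (level_prod c) 2))
            (N.pow 58 (N.pow 2 (N.of_nat c.1))),
      special 2 [:: 4; 3; 3]%N c | special 3 [:: 2; 2; 3; 3; 3; 3; 4]%N c].

Lemma configs5_ok : all config_ok (configs 5).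
Proof. by vm_compute. Qed.

Lemma mem_bitvecs k v : (v \in bitvecs k) = (size v == k).
Proof.
elim: k v => [|k IH] [|b v] //=.
  by rewrite mem_cat; apply/negP => /orP[]/mapP[].
rewrite eqSS -IH mem_cat.
have inj c : injective (cons c : seq bool -> _) by move=> x y [].
have diff c d (s : seq (seq bool)) : c != d -> (c :: v \in [seq d :: w | w <- s]) = false.
  by move=> /eqP ncd; apply/negP => /mapP[w _ []].
by case: b; rewrite (mem_map (@inj _)) diff ?orbF.
Qed.

Lemma bdot_nseq0 k t : bdot (nseq k false) t = false.
Proof. by elim: k t => [|k IH] [|b t] //=. Qed.

Lemma bdot0 u t : ~~ has id u -> bdot u t = false.
Proof. by elim: u t => [|[] u IH] [|b t] //=; exact: IH. Qed.

(** * Odd sets as characters over the two-element field *)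

Section OddBasis.
Variable G : finZmodType.
Implicit Types (B C : {set G}) (bs cs : seq {set G}) (x g : G).

Definition bits bs x : seq bool := [seq x \in B | B : {set G} <- bs].

(** Linear independence in triangular form: adding the witness [g] flips membership in [B] and
    leaves membership in the later sets unchanged. *)
Fixpoint odd_basis bs : Prop :=
  if bs is B :: bs' then
    [/\ odd_set B, exists2 g, g \in B & ~~ has id (bits bs' g) & odd_basis bs']
  else True.

Definition all_odd bs : Prop := forall B, B \in bs -> odd_set B.

Lemma odd_basis_odd bs : odd_basis bs -> all_odd bs.
Proof.
elim: bs => [|B bs IH] //= [oB _ /IH obs] C; rewrite inE => /predU1P[->|] //.
exact: obs.
Qed.

Lemma bits_kerD bs x g : all_odd bs -> ~~ has id (bits bs g) ->
  bits bs (x + g) = bits bs x.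
Proof.
move=> obs /hasPn gk; apply/eq_in_map => B Bbs; rewrite obs //.
by rewrite (negbTE (gk (g \in B) _)) ?addbF //; apply: map_f.
Qed.

Lemma odd_basis_surj bs t : odd_basis bs -> size t = size bs ->
  exists x, bits bs x = t.
Proof.
elim: bs t => [|B bs IH] [|b t] //=; first by move=> _ _; exists 0.
case=> oB [g gB gk] obs [/(IH _ obs)[x xt]].
have [xb|xb] := eqVneq (x \in B) b; first by exists x; rewrite /= xb xt.
exists (x + g); rewrite /= oB gB bits_kerD ?xt //; last exact: odd_basis_odd.
by congr (_ :: _); case: (x \in B) b xb => [] [].
Qed.

(** Induction on the list: if [C] or [C + B] is a combination of the tail, [C] is a combination of
    [B :: bs]. Otherwise the common kernel of the tail contains some [g] in [C] and some [h] in
    [symdiff C B], and one of [g], [h], [g + h] lies in [C] but not in [B]. *)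
Lemma odd_dichotomy bs C : all_odd bs -> odd_set C ->
  (exists2 g, g \in C & ~~ has id (bits bs g)) \/
  exists2 u, size u = size bs & forall x, (x \in C) = bdot u (bits bs x).
Proof.
elim: bs C => [|B bs IH] C obs oC.
  have [->|[g gC]] := set_0Vmem C; last by left; exists g.
  by right; exists [::] => // x; rewrite inE.
have oB : odd_set B by apply: obs; rewrite mem_head.
have obs' : all_odd bs by move=> D Dbs; apply: obs; rewrite inE Dbs orbT.
case: (IH C obs' oC) => [[g gC gk]|[u su uC]]; last first.
  by right; exists (false :: u) => [|x]; rewrite /= ?su ?uC.
have [gB|gB] := boolP (g \in B); last first.
  by left; exists g => //=; rewrite negb_or gB.
case: (IH _ obs' (odd_set_symdiff oC oB)) => [[h hC hk]|[u su uC]]; last first.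
  right; exists (true :: u) => [|x]; rewrite /= ?su // -uC !inE.
  by case: (x \in B); case: (x \in C).
left; have [hB|hB] := boolP (h \in B); last first.
  exists h => /=; last by rewrite negb_or hB.
  by move: hC; rewrite !inE (negbTE hB); case: (h \in C).
have hnC : h \notin C by move: hC; rewrite !inE hB; case: (h \in C).
exists (g + h); first by rewrite oC gC (negbTE hnC).
by rewrite /= oB gB hB /= bits_kerD.
Qed.

(** The two branches of [configs] match [odd_dichotomy]: an independent set joins the front of the
    basis as a new first coordinate, a dependent one gets a coordinate vector, nonzero because the
    set is nonempty. *)
Lemma configP cs : all_odd cs -> set0 \notin cs ->
  exists2 bs, odd_basis bs & exists2 us, (size bs, us) \in configs (size cs)
    & forall x, bits cs x = [seq bdot u (bits bs x) | u <- us].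
Proof.
elim: cs => [|C cs IH] ocs; first by exists [::] => //; exists [::].
rewrite inE negb_or eq_sym => /andP[/set0Pn[c cC] cs0].
have oC : odd_set C by apply: ocs; rewrite mem_head.
have [|bs obs [us usc usE]] := IH _ cs0.
  by move=> D Dcs; apply: ocs; rewrite inE Dcs orbT.
have [[g gC gk]|[u su uC]] := odd_dichotomy (odd_basis_odd obs) oC.
  exists (C :: bs); first by split=> //; exists g.
  exists ((true :: nseq (size bs) false) :: map (cons false) us).
    by apply/flattenP; eexists; [apply: (map_f _ usc)|rewrite mem_head].
  by move=> x /=; rewrite usE bdot_nseq0 addbF -map_comp.
exists bs => //; exists (u :: us); last by move=> x /=; rewrite usE uC.
apply/flattenP; eexists; first by apply: (map_f _ usc).
rewrite inE; apply/orP; right; apply/mapP; exists u => //.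
rewrite mem_filter mem_bitvecs su eqxx andbT; apply/negPn/negP => u0.
by move: cC; rewrite uC bdot0.
Qed.

(** Independent characters are equidistributed: the map [x -> x + g] pairs the elements of [B] with
    those outside it and fixes all later bits. *)
Lemma odd_basis_sum (R : realType) bs (w : seq bool -> R) : odd_basis bs ->
  2 ^+ size bs * \sum_(x : G) w (bits bs x)
    = #|G|%:R * \sum_(t <- bitvecs (size bs)) w t.
Proof.
elim: bs w => [|B bs IH] w /=.
  by move=> _; rewrite big_seq1 mul1r sumr_const mulr_natl.
case=> oB [g gB gk] obs.
have -> : \sum_(t <- [seq false :: v | v <- bitvecs (size bs)] ++
                    [seq true :: v | v <- bitvecs (size bs)]) w t =
          \sum_(t <- bitvecs (size bs)) (w (false :: t) + w (true :: t)).
  by rewrite big_cat !big_map big_split.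
rewrite -(IH (fun t => w (false :: t) + w (true :: t))) // exprSr -mulrA.
congr (_ * _); rewrite mulrC mulr_natr mulr2n.
rewrite {2}(reindex_inj (addIr g)) -big_split /=; apply: eq_bigr => x _.
rewrite oB gB bits_kerD ?addbT //; last exact: odd_basis_odd.
by case: (x \in B); rewrite // addrC.
Qed.

End OddBasis.

Lemma tuple_select (T : eqType) k m (t : k.-tuple T) (s : m.-tuple T) :
  (forall i, tnth s i \in t) ->
  exists f : 'I_m -> 'I_k, [tuple tnth t (f i) | i < m] = s.
Proof.
move=> st; have /fin_all_exists[f fE] i : exists j, tnth t j = tnth s i.
  by have /tnthP[j ->] := st i; exists j.
by exists f; apply: eq_from_tnth => i; rewrite tnth_mktuple.
Qed.

(** * Atoms of the two exceptional configurations *)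

Section Special.
Variable G : finZmodType.
Implicit Types (B C : {set G}) (bs : seq {set G}) (x : G).

Lemma mem_atom t (Bs : t.-tuple {set G}) e x :
  (x \in atom Bs e) = (bits Bs x == e).
Proof.
have nthE (i : 'I_t) : nth false (bits Bs x) i = (x \in tnth Bs i).
  by rewrite (nth_map set0) ?size_tuple // -tnth_nth.
apply/bigcapP/eqP => [xe|be i _].
  apply: (@eq_from_nth _ false); first by rewrite size_map !size_tuple.
  move=> i; rewrite size_map size_tuple => lti.
  have := xe (Ordinal lti) isT; rewrite (nthE (Ordinal lti)).
  rewrite -(tnth_nth false e (Ordinal lti)).
  by case: (tnth e _) => //; rewrite inE => /negbTE.
have := nthE i; rewrite be -tnth_nth => ->.
by case: ifPn => // nx; rewrite inE.
Qed.

Lemma atom_levelE t (e : t.-tuple bool) : atom_level e = count id e.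
Proof.
rewrite -sum1_count big_mkcond big_tuple; apply: eq_bigr => i _.
by case: (tnth e i).
Qed.

Lemma consists_of_patterns t (Bs : t.-tuple {set G}) bs us ks :
  odd_basis bs -> (forall x, bits Bs x = [seq bdot u (bits bs x) | u <- us]) ->
  uniq (patterns (size bs, us)) ->
  perm_eq [seq l <- levels (size bs, us) | l != 0%N] ks ->
  consists_of Bs ks.
Proof.
set c := (size bs, us) => obs BsE upat perm_ks.
have sz_us : size us = t by have := congr1 size (BsE 0); rewrite !size_map size_tuple.
have pat_bits x : bits Bs x \in patterns c.
  by rewrite BsE; apply: map_f; rewrite mem_bitvecs size_map.
have bits_pat v : v \in patterns c -> exists x, bits Bs x = v.
  case/mapP=> s; rewrite mem_bitvecs => /eqP/(odd_basis_surj obs)[x <-] ->.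
  by exists x; rewrite BsE.
(* The all-false pattern indexes the complement of the union and is left out. The other patterns
   index nonempty atoms, because every point of the space is realized by a group element. *)
pose E := [set e : t.-tuple bool | (val e \in patterns c) && has id e].
have has_bits x : has id (bits Bs x) = (x \in \bigcup_(i < t) tnth Bs i).
  apply/hasP/bigcupP => [[_ /mapP[B /tnthP[i ->] ->] xB]|[i _ xB]]; first by exists i.
  by exists true => //; apply/mapP; exists (tnth Bs i) => //; apply: mem_tnth.
have bits_sz x : size (bits Bs x) == t by rewrite size_map size_tuple.
apply/existsP; exists E; apply/andP; split.
  apply/and3P; split.
  - apply/eqP/setP=> x; rewrite -has_bits; apply/bigcupP/idP.
      case=> _ /imsetP[e eE ->]; rewrite mem_atom => /eqP ->.
      by move: eE; rewrite inE => /andP[].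
    move=> hx; exists (atom Bs (Tuple (bits_sz x))); last by rewrite mem_atom.
    by apply: imset_f; rewrite inE pat_bits.
  - apply/trivIsetP => _ _ /imsetP[e _ ->] /imsetP[e' _ ->] nee.
    rewrite -setI_eq0; apply/set0Pn => -[x]; rewrite inE !mem_atom.
    case/andP=> /eqP xe /eqP xe'; case/eqP: nee; congr (atom Bs _).
    by apply: val_inj; rewrite -[LHS]xe.
  - apply/imsetP => -[e]; rewrite inE => /andP[/bits_pat[x xe] _] /setP/(_ x).
    by rewrite inE mem_atom xe eqxx.
apply: perm_trans perm_ks.
have -> : [seq l <- levels c | l != 0%N]
        = map (count id) [seq v <- patterns c | has id v].
  rewrite filter_map; congr map; apply: eq_filter => v /=.
  by rewrite has_count lt0n.
rewrite (eq_map (@atom_levelE t)) (map_comp (count id) val); apply: perm_map.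
apply: uniq_perm; first by rewrite (map_inj_uniq val_inj) enum_uniq.
  exact: filter_uniq.
move=> v; rewrite mem_filter; apply/mapP/andP.
  by case=> e; rewrite mem_enum inE => /andP[ep eh] ->.
case=> hv vp; have sv : size v == t by case/mapP: vp => s _ ->; rewrite size_map sz_us.
by exists (Tuple sv) => //; rewrite mem_enum inE vp.
Qed.

Lemma bits_tnth t (Bs : t.-tuple {set G}) bs us i :
  (forall x, bits Bs x = [seq bdot u (bits bs x) | u <- us]) ->
  exists u, forall x, (x \in tnth Bs i) = bdot u (bits bs x).
Proof.
move=> BsE; have sz_us : size us = t.
  by have := congr1 size (BsE 0); rewrite !size_map size_tuple.
exists (nth [::] us i) => x.
rewrite -(nth_map [::] false (fun u => bdot u (bits bs x))) ?sz_us // -BsE.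
by rewrite (nth_map set0) ?size_tuple // -tnth_nth.
Qed.

Lemma odd_basis_neq bs u v B C t : odd_basis bs ->
  (forall x, (x \in B) = bdot u (bits bs x)) ->
  (forall x, (x \in C) = bdot v (bits bs x)) ->
  size t = size bs -> bdot u t != bdot v t -> B != C.
Proof.
move=> obs BE CE /(odd_basis_surj obs)[x <-]; rewrite -BE -CE.
by apply: contraNneq => ->.
Qed.

Lemma special2 t (Bs : t.-tuple {set G}) b1 b2 us : odd_basis [:: b1; b2] ->
  (forall x, bits Bs x = [seq bdot u (bits [:: b1; b2] x) | u <- us]) ->
  set0 \notin Bs ->
  [/\ largest_sum_free b1, largest_sum_free b2 & largest_sum_free (symdiff b1 b2)]
  /\ exists f : 'I_t -> 'I_3,
       [tuple tnth [tuple b1; b2; symdiff b1 b2] (f i) | i < t] = Bs.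
Proof.
set bs := [:: b1; b2] => obs BsE Bs0; have [o1 _ [o2 _ _]] := obs.
(* The empty list acts as the zero vector and describes the empty set, so nonemptiness is a case of
   [odd_basis_neq]. *)
have ne B u s : (forall x, (x \in B) = bdot u (bits bs x)) ->
    size s = size bs -> bdot u s -> B != set0.
  by move=> BE ss us1; apply: (@odd_basis_neq bs u [::] _ _ s) => // [x|]; rewrite ?us1 ?inE.
have n1 : b1 != set0.
  by apply: (@ne _ [:: true; false] [:: true; false]) => //= x; rewrite addbF.
have n2 : b2 != set0.
  by apply: (@ne _ [:: false; true] [:: false; true]) => //= x; rewrite addbF.
have n12 : symdiff b1 b2 != set0.
  apply: (@ne _ [:: true; true] [:: true; false]) => //= x; rewrite addbF !inE.
  by case: (x \in b1); case: (x \in b2).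
split; first by split; apply: odd_set_largest => //; apply: odd_set_symdiff.
apply: tuple_select => i; have [u uE] := bits_tnth i BsE.
have uE2 B : (forall x, bdot u (bits bs x) = (x \in B)) -> tnth Bs i = B.
  by move=> h; apply/setP=> x; rewrite uE h.
have : tnth Bs i != set0 by apply: contraNneq Bs0 => <-; apply: mem_tnth.
rewrite !inE; case: u uE uE2 => [|p u] uE uE2.
  by rewrite (uE2 set0) ?eqxx // => x; rewrite inE.
case: u uE uE2 => [|q u] uE uE2.
  case: p uE uE2 => uE uE2; first by rewrite (uE2 b1) ?eqxx // => x /=; rewrite addbF.
  by rewrite (uE2 set0) ?eqxx // => x; rewrite inE.
have uE3 : forall x, bdot (p :: q :: u) (bits bs x) = (p && (x \in b1)) (+) (q && (x \in b2)).
  by move=> x; rewrite /bs; case: (u) => [|? ?] /=; rewrite ?addbF.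
move=> nz; case: p q uE uE2 uE3 => [] [] uE uE2 uE3.
- rewrite (uE2 (symdiff b1 b2)) ?eqxx ?orbT // => x; rewrite uE3 !inE.
  by case: (x \in b1); case: (x \in b2).
- by rewrite (uE2 b1) ?eqxx // => x; rewrite uE3 /= addbF.
- by rewrite (uE2 b2) ?eqxx ?orbT // => x; rewrite uE3.
- by move: nz; rewrite (uE2 set0) ?eqxx // => x; rewrite uE3 inE.
Qed.

(** Three independent characters span seven nonzero ones; [B4] to [B7] are the sums of two or three
    of them. A sum vanishes wherever all its terms do, hence the inclusion in the union. *)
Lemma special3 t (Bs : t.-tuple {set G}) b1 b2 b3 us : odd_basis [:: b1; b2; b3] ->
  (forall x, bits Bs x = [seq bdot u (bits [:: b1; b2; b3] x) | u <- us]) ->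
  set0 \notin Bs ->
  [/\ largest_sum_free b1, largest_sum_free b2 & largest_sum_free b3]
  /\ exists B4 B5 B6 B7 : {set G},
     [/\ uniq [:: B4; B5; B6; B7], all (@largest_sum_free G) [:: B4; B5; B6; B7],
         all (fun B : {set G} => B \subset b1 :|: b2 :|: b3) [:: B4; B5; B6; B7]
       & exists f : 'I_t -> 'I_7,
           [tuple tnth [tuple b1; b2; b3; B4; B5; B6; B7] (f i) | i < t] = Bs].
Proof.
set bs := [:: b1; b2; b3] => obs BsE Bs0; have [o1 _ [o2 _ [o3 _ _]]] := obs.
have neq := @odd_basis_neq bs _ _ _ _ _ obs.
have ne B u s : (forall x, (x \in B) = bdot u (bits bs x)) ->
    size s = size bs -> bdot u s -> B != set0.
  by move=> BE ss us1; apply: (@odd_basis_neq bs u [::] _ _ s) => // [x|]; rewrite ?us1 ?inE.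
have e1 x : (x \in b1) = bdot [:: true; false; false] (bits bs x) by rewrite /= addbF.
have e2 x : (x \in b2) = bdot [:: false; true; false] (bits bs x) by rewrite /= addbF.
have e3 x : (x \in b3) = bdot [:: false; false; true] (bits bs x) by rewrite /= addbF.
pose b12 := symdiff b1 b2; pose b13 := symdiff b1 b3.
pose b23 := symdiff b2 b3; pose b123 := symdiff b1 (symdiff b2 b3).
have e12 x : (x \in b12) = bdot [:: true; true; false] (bits bs x).
  by rewrite /= !inE; case: (x \in b1); case: (x \in b2).
have e13 x : (x \in b13) = bdot [:: true; false; true] (bits bs x).
  by rewrite /= !inE; case: (x \in b1); case: (x \in b3).
have e23 x : (x \in b23) = bdot [:: false; true; true] (bits bs x).
  by rewrite /= !inE; case: (x \in b2); case: (x \in b3).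
have e123 x : (x \in b123) = bdot [:: true; true; true] (bits bs x).
  by rewrite /= !inE; case: (x \in b1); case: (x \in b2); case: (x \in b3).
split.
  split; apply: odd_set_largest => //.
  - exact: (ne _ _ [:: true; false; false] e1).
  - exact: (ne _ _ [:: false; true; false] e2).
  - exact: (ne _ _ [:: false; false; true] e3).
exists b12, b13, b23, b123; split.
- rewrite /= !inE !negb_or !andbT -!andbA.
  apply/and5P; split; last apply/andP; try split.
  + exact: (neq _ _ _ _ [:: false; true; false] e12 e13).
  + exact: (neq _ _ _ _ [:: true; false; false] e12 e23).
  + exact: (neq _ _ _ _ [:: false; false; true] e12 e123).
  + exact: (neq _ _ _ _ [:: true; false; false] e13 e23).
  + exact: (neq _ _ _ _ [:: false; true; false] e13 e123).
  + exact: (neq _ _ _ _ [:: true; false; false] e23 e123).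
- rewrite /= !andbT; apply/and4P; split; apply: odd_set_largest.
  + exact: odd_set_symdiff.
  + exact: (ne _ _ [:: true; false; false] e12).
  + exact: odd_set_symdiff.
  + exact: (ne _ _ [:: true; false; false] e13).
  + exact: odd_set_symdiff.
  + exact: (ne _ _ [:: false; true; false] e23).
  + by do 2 apply: odd_set_symdiff => //.
  + exact: (ne _ _ [:: true; false; false] e123).
- rewrite /= !andbT; apply/and4P; split; apply/subsetP=> x; rewrite !inE;
  by case: (x \in b1); case: (x \in b2); case: (x \in b3).
apply: tuple_select => i; have [u uE] := bits_tnth i BsE.
(* Padding with [false] or truncating to length three does not change the product with three bits,
   and leaves eight cases. *)
pose v := [:: nth false u 0; nth false u 1; nth false u 2].
have {}uE x : (x \in tnth Bs i) = bdot v (bits bs x).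
  rewrite uE /v /bs; case: u {uE v} => [|p [|q [|r [|s u]]]] /=; rewrite ?andbF ?addbF //.
have uE2 (B : {set G}) : (forall x, (x \in B) = bdot v (bits bs x)) -> tnth Bs i = B.
  by move=> h; apply/setP=> x; rewrite uE h.
have nz : tnth Bs i != set0 by apply: contraNneq Bs0 => <-; apply: mem_tnth.
rewrite !inE; move: uE2; rewrite /v.
case: (nth false u 0); case: (nth false u 1); case: (nth false u 2) => uE2.
- by rewrite (uE2 _ e123) eqxx ?orbT.
- by rewrite (uE2 _ e12) eqxx ?orbT.
- by rewrite (uE2 _ e13) eqxx ?orbT.
- by rewrite (uE2 _ e1) eqxx ?orbT.
- by rewrite (uE2 _ e23) eqxx ?orbT.
- by rewrite (uE2 _ e2) eqxx ?orbT.
- by rewrite (uE2 _ e3) eqxx ?orbT.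
- by case/eqP: nz; apply: uE2 => x; rewrite inE.
Qed.

End Special.

(** * Weights of five cleaned containers *)

Section Multiplicity.
Variable G : finZmodType.
Implicit Types (A B C : {set G}) (x : G).

Definition mult (I : finType) (F : I -> {set G}) x : nat := #|[set i | x \in F i]|.

Lemma sum_mult (I : finType) (F : I -> {set G}) :
  (\sum_x mult F x = \sum_i #|F i|)%N.
Proof.
under eq_bigr do rewrite /mult -sum1dep_card big_mkcond.
rewrite exchange_big; apply: eq_bigr => i _.
by rewrite -big_mkcond sum1_card.
Qed.

(** The color of [x] is one of the indices [i] whose container holds [x]. *)
Lemma card_assigned r A (FF : {set {set G}}) (g : coloring r A -> r.-tuple {set G})
    (Fs : r.-tuple {set G}) : container_assignment FF g ->
  (#|assigned_colorings g Fs| <= \prod_(x in A) mult (tnth Fs) x)%N.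
Proof.
move=> gP; rewrite (big_sub (mem A)).
pose P (x : {x : G | x \in A}) := [pred i : 'I_r | val x \in tnth Fs i].
have -> : (\prod_(x : {x : G | x \in A}) mult (tnth Fs) (val x) = #|family P|)%N.
  rewrite card_family foldrE big_image /=; apply: eq_bigr => x _.
  by rewrite /mult cardsE.
apply/subset_leq_card/subsetP=> phi; rewrite inE => /andP[sphi /eqP gphi].
apply/familyP=> x; rewrite inE; have [_ /subsetP] := gP phi sphi (phi x).
by rewrite gphi; apply; apply/imsetP; exists x => //; rewrite inE.
Qed.

Lemma assigned_cover r A (FF : {set {set G}}) (g : coloring r A -> r.-tuple {set G})
    (Fs : r.-tuple {set G}) : container_assignment FF g ->
  (0 < #|assigned_colorings g Fs|)%N -> A \subset \bigcup_i tnth Fs i.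
Proof.
move=> gP /card_gt0P[phi]; rewrite inE => /andP[sphi /eqP gphi].
apply/subsetP=> x xA; have [_ /subsetP sub] := gP phi sphi (phi (Sub x xA)).
apply/bigcupP; exists (phi (Sub x xA)) => //; rewrite -gphi; apply: sub.
by apply/imsetP; exists (Sub x xA) => //; rewrite inE.
Qed.

Variable R : realType.

(** The maximum with 1 gives weight 0 to points in no container, so that sums can run over the whole
    group. *)
Definition lnmax1 (k : nat) : R := ln (maxn 1 k)%:R.

Lemma lnmax1_le k l : (k <= l)%N -> lnmax1 k <= lnmax1 l.
Proof. by move=> kl; rewrite ler_ln ?posrE ?ltr0n ?ler_nat; lia. Qed.

Lemma ln_prod (I : Type) (s : seq I) (f : I -> nat) : (forall i, 0 < f i)%N ->
  ln ((\prod_(i <- s) f i)%N%:R : R) = \sum_(i <- s) ln (f i)%:R.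
Proof.
move=> f0; elim: s => [|i s IH]; first by rewrite !big_nil ln1.
rewrite !big_cons natrM lnM ?IH // posrE ltr0n //.
by rewrite prodn_gt0.
Qed.

(** Passing to [F] can lower the multiplicity only at points of some [tnth Fs i :\: F i]; there the
    factor is at most [r.+1], and each such point is counted at least once in the first sum. *)
Lemma ln_card_assigned r A (FF : {set {set G}})
    (g : coloring r.+1 A -> r.+1.-tuple {set G})
    (Fs : r.+1.-tuple {set G}) (F : 'I_r.+1 -> {set G}) :
  container_assignment FF g -> (0 < #|assigned_colorings g Fs|)%N ->
  ln (#|assigned_colorings g Fs|%:R : R) <=
    ln r.+1%:R * \sum_i #|tnth Fs i :\: F i|%:R + \sum_x lnmax1 (mult F x).
Proof.
move=> gP h0; have hc := card_assigned Fs gP.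
have h1 : (#|assigned_colorings g Fs| <= \prod_x maxn 1 (mult (tnth Fs) x))%N.
  apply: leq_trans hc _; rewrite big_mkcond; apply: leq_prod => x _.
  by case: ifP => _; rewrite ?leq_maxl ?leq_maxr.
have : ln (#|assigned_colorings g Fs|%:R : R) <= \sum_x lnmax1 (mult (tnth Fs) x).
  rewrite -(ln_prod _ (fun x => leq_maxl 1 (mult (tnth Fs) x))).
  by rewrite ler_ln ?posrE ?ltr0n ?ler_nat //; apply: leq_trans h1.
move=> /le_trans; apply; rewrite -natr_sum -sum_mult natr_sum mulr_sumr -big_split.
apply: ler_sum => x _; rewrite /=.
have [bad0|bad] := posnP (mult (fun i => tnth Fs i :\: F i) x).
  rewrite bad0 mulr0 add0r; apply: lnmax1_le; apply/subset_leq_card/subsetP=> i.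
  rewrite !inE => xF; have : i \notin [set i | x \in tnth Fs i :\: F i].
    by rewrite (cards0_eq bad0) inE.
  by rewrite !inE xF andbT negbK.
have le_r : (mult (tnth Fs) x <= r.+1)%N.
  by rewrite -[leqRHS]card_ord; apply: max_card.
have l0 : 0 <= ln (r.+1%:R : R) by rewrite ln_ge0 // ler1n.
have m0 : 0 <= lnmax1 (mult F x) by rewrite ln_ge0 // ler1n; lia.
have : lnmax1 (mult (tnth Fs) x) <= ln (r.+1%:R : R).
  by rewrite ler_ln ?posrE ?ltr0n ?ler_nat; lia.
have : ln (r.+1%:R : R) <= ln r.+1%:R * (mult (fun i => tnth Fs i :\: F i) x)%:R.
  by rewrite ler_peMr // ler1n.
lra.
Qed.

End Multiplicity.

(** * Inequalities between the logarithms of 2, 3 and 5 *)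

Section Logs.
Variable R : realType.
Notation L2 := (ln (2%:R : R)).
Notation L3 := (ln (3%:R : R)).
Notation L5 := (ln (5%:R : R)).

Lemma ln_monomial (a b c : nat) :
  ln (2%:R ^+ a * 3%:R ^+ b * 5%:R ^+ c : R) = a%:R * L2 + b%:R * L3 + c%:R * L5.
Proof.
rewrite !lnM ?posrE ?mulr_gt0 ?exprn_gt0 ?ltr0n //.
by rewrite !lnXn ?ltr0n // !mulr_natl.
Qed.

Lemma ln_monomial_le (a b c a' b' c' : nat) :
  (2 ^ a * 3 ^ b * 5 ^ c <= 2 ^ a' * 3 ^ b' * 5 ^ c')%N ->
  a%:R * L2 + b%:R * L3 + c%:R * L5 <= a'%:R * L2 + b'%:R * L3 + c'%:R * L5.
Proof.
move=> h; rewrite -!ln_monomial ler_ln ?posrE ?mulr_gt0 ?exprn_gt0 ?ltr0n //.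
by move: h; rewrite -(ler_nat R) !natrM !natrX.
Qed.

(** Input for [lra], obtained from integer inequalities. The last three compare [3^6 * 2^2],
    [2^2 * 5^4] and [3^7] with [2^10 * 3], for the cases of [unique_weight]. *)
Lemma ln_facts : [/\ 0 < L2, 3 * L2 <= 2 * L3, L3 <= 2 * L2 & L3 + L5 <= 4 * L2] /\
  [/\ 7 * L3 <= 12 * L2, 4 * L3 <= 7 * L2, 2 * L2 <= L5 & 3 * L5 <= 5 * L3]
  /\ 6 * L3 + 2 * L2 <= 10 * L2 + L3 /\ 2 * L2 + 4 * L5 <= 10 * L2 + L3
  /\ 7 * L3 <= 10 * L2 + L3.
Proof.
have p2 : 0 < L2 by rewrite ln_gt0 // ltr1n.
have h1 := @ln_monomial_le 3 0 0 0 2 0 isT.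
have h2 := @ln_monomial_le 0 1 0 2 0 0 isT.
have h3 := @ln_monomial_le 0 1 1 4 0 0 isT.
have h4 := @ln_monomial_le 0 7 0 12 0 0 isT.
have h5 := @ln_monomial_le 0 4 0 7 0 0 isT.
have h6 := @ln_monomial_le 2 0 0 0 0 1 isT.
have h7 := @ln_monomial_le 0 0 3 0 5 0 isT.
have h8 := @ln_monomial_le 2 6 0 10 1 0 isT.
have h9 := @ln_monomial_le 2 0 4 10 1 0 isT.
have h10 := @ln_monomial_le 0 7 0 10 1 0 isT.
by do !split; lra.
Qed.

Lemma lnmax1E : [/\ lnmax1 R 0 = 0, lnmax1 R 1 = 0, lnmax1 R 2 = L2, lnmax1 R 3 = L3
  & lnmax1 R 4 = 2 * L2] /\ lnmax1 R 5 = L5.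
Proof.
have l4 : lnmax1 R 4 = 2 * L2.
  rewrite (_ : 2 * L2 = ln (2%:R ^+ 2)); last by rewrite lnXn ?ltr0n // mulr_natl.
  by rewrite /lnmax1 -natrX.
by do !split => //; rewrite /lnmax1 /= ln1.
Qed.

Lemma lnmax1_third k : (k <= 5)%N -> lnmax1 R k <= L3 / 3 * k%:R.
Proof.
have [[h1 h2 h3 h4] [[h5 h6 h7 h8] _]] := ln_facts.
have [[e0 e1 e2 e3 e4] e5] := lnmax1E.
by case: k => [|[|[|[|[|[|//]]]]]] _; rewrite ?e0 ?e1 ?e2 ?e3 ?e4 ?e5; lra.
Qed.

End Logs.

Lemma to_nat_leb a b : N.leb a b -> (N.to_nat a <= N.to_nat b)%N.
Proof. by move/N.leb_le => le_ab; apply/ssrnat.leP; lia. Qed.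

Lemma to_nat_pow a b : N.to_nat (N.pow a b) = (N.to_nat a ^ N.to_nat b)%N.
Proof. by rewrite N2Nat.inj_pow; elim: (N.to_nat b) => //= n ->; rewrite expnS. Qed.

Lemma level_prodE c :
  N.to_nat (level_prod c) = (\prod_(l <- levels c) maxn 1 l)%N.
Proof.
rewrite /level_prod; elim: (levels c) => [|l s IH]; first by rewrite big_nil.
rewrite big_cons -IH [LHS]N2Nat.inj_mul N2Nat.inj_max Nat2N.id.
by congr (_ * _)%N; case: l => [|[|l]].
Qed.

(** * Five sets: the base 5.8 or an exceptional configuration *)

Section FiveSets.
Variables (G : finZmodType) (R : realType).
Implicit Types (A B C : {set G}) (x : G).
Notation L2 := (ln (2%:R : R)).
Notation L3 := (ln (3%:R : R)).
Notation L5 := (ln (5%:R : R)).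
Notation n := (#|G|%:R : R).

Lemma mult_bits t (Bs : t.-tuple {set G}) x : mult (tnth Bs) x = count id (bits Bs x).
Proof. by rewrite /mult -sum1dep_card -sum1_count big_map big_tuple. Qed.

Lemma mult_mono (I : finType) (F F' : I -> {set G}) x :
  (forall i, F i \subset F' i) -> (mult F x <= mult F' x)%N.
Proof.
move=> sF; apply/subset_leq_card/subsetP=> i; rewrite !inE.
exact: (subsetP (sF i)).
Qed.

Definition two_char_config t (Bs : t.-tuple {set G}) : Prop :=
  exists B1 B2 : {set G},
    [/\ largest_sum_free B1, largest_sum_free B2 & largest_sum_free (symdiff B1 B2)]
    /\ (exists f : 'I_t -> 'I_3,
         [tuple tnth [tuple B1; B2; symdiff B1 B2] (f i) | i < t] = Bs)
    /\ consists_of Bs [:: 4; 3; 3]%N.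

Definition three_char_config t (Bs : t.-tuple {set G}) : Prop :=
  exists B1 B2 B3 : {set G},
    [/\ largest_sum_free B1, largest_sum_free B2 & largest_sum_free B3]
    /\ (exists B4 B5 B6 B7 : {set G},
     [/\ uniq [:: B4; B5; B6; B7], all (@largest_sum_free G) [:: B4; B5; B6; B7],
         all (fun B : {set G} => B \subset B1 :|: B2 :|: B3) [:: B4; B5; B6; B7]
       & exists f : 'I_t -> 'I_7,
           [tuple tnth [tuple B1; B2; B3; B4; B5; B6; B7] (f i) | i < t] = Bs])
    /\ consists_of Bs [:: 2; 2; 3; 3; 3; 3; 4]%N.

(** By equidistribution the total weight is [n / 2^k] times the logarithm of the product of the
    levels, where [k] is the rank of the characters; the finite check [configs5_ok] then decides. *)
Lemma odd_sets_weight (Bs : 5.-tuple {set G}) : all_odd Bs -> set0 \notin Bs ->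
  [\/ \sum_x lnmax1 R (mult (tnth Bs) x) <= n / 2 * ln (58 / 10),
      two_char_config Bs | three_char_config Bs].
Proof.
move=> oBs Bs0; have [bs obs [us usc BsE]] := configP oBs Bs0.
rewrite size_tuple in usc.
have /or3P[h|/and3P[/eqP k2 up pm]|/and3P[/eqP k3 up pm]] :=
  allP configs5_ok _ usc; last 2 first.
- apply: Or32; case: bs k2 obs usc BsE up pm => [|b1 [|b2 [|]]] // _ obs usc BsE up pm.
  have [h1 h2] := special2 obs BsE Bs0.
  by exists b1, b2; split=> //; split=> //; apply: (consists_of_patterns obs BsE up pm).
- apply: Or33; case: bs k3 obs usc BsE up pm => [|b1 [|b2 [|b3 [|]]]] // _ obs usc BsE up pm.
  have [h1 h2] := special3 obs BsE Bs0.
  by exists b1, b2, b3; split=> //; split=> //; apply: (consists_of_patterns obs BsE up pm).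
apply: Or31; move: h; set c := (size bs, us); set k := size bs => h.
pose P := (\prod_(l <- levels c) maxn 1 l)%N.
have P0 : (0 < P)%N by rewrite prodn_gt0 // => i; rewrite leq_maxl.
have {}h : (10 ^ (2 ^ k) * P ^ 2 <= 58 ^ (2 ^ k))%N.
  move/to_nat_leb: h; rewrite [N.to_nat (N.mul _ _)]N2Nat.inj_mul.
  by rewrite !to_nat_pow Nat2N.id level_prodE.
have lnP : 2 * ln (P%:R : R) <= 2 ^+ k * ln (58 / 10).
  have : ln ((10 ^ (2 ^ k) * P ^ 2)%N%:R : R) <= ln (58 ^ (2 ^ k))%N%:R.
    by rewrite ler_ln ?posrE ?ltr0n ?ler_nat ?muln_gt0 ?expn_gt0 ?P0.
  rewrite natrM !natrX lnM ?posrE ?exprn_gt0 ?ltr0n // !lnXn ?ltr0n //.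
  rewrite ln_div ?posrE ?ltr0n //; move: (ln 10) (ln 58) (ln P%:R) => a b p.
  rewrite -[a *+ _]mulr_natl -[p *+ _]mulr_natl -[b *+ _]mulr_natl natrX; lra.
pose w v := lnmax1 R (count id [seq bdot u v | u <- us]).
have sumE : \sum_x lnmax1 R (mult (tnth Bs) x) = \sum_x w (bits bs x).
  by apply: eq_bigr => x _; rewrite mult_bits BsE.
have sumP : \sum_(t <- bitvecs k) w t = ln (P%:R : R).
  rewrite ln_prod; last by move=> i; rewrite leq_maxl.
  by rewrite /levels /patterns !big_map.
have := odd_basis_sum w obs; rewrite -sumE -/k sumP => e.
have p2 : 0 < 2 ^+ k :> R by rewrite exprn_gt0 // ltr0n.
rewrite -(ler_pM2l p2) e.
have n0 : 0 <= n by rewrite ler0n.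
have := ler_wpM2l n0 lnP; lra.
Qed.

Variables (F : 'I_5 -> {set G}) (e : nat).
Hypothesis ovF : forall i, {in F i, forall a, overlap (F i) a <= e}%N.

Let mult5 x : (mult F x <= 5)%N.
Proof. by rewrite -[leqRHS]card_ord; apply: max_card. Qed.

Let L3_gt0 : 0 < L3. Proof. by rewrite ln_gt0 // ltr1n. Qed.

Lemma weight_le_sum (N : R) :
  (\sum_i #|F i|)%N%:R <= N -> \sum_x lnmax1 R (mult F x) <= L3 / 3 * N.
Proof.
move=> leN; apply: (@le_trans _ _ (L3 / 3 * (\sum_i #|F i|)%N%:R)).
  rewrite -sum_mult natr_sum mulr_sumr; apply: ler_sum => x _.
  exact/lnmax1_third/mult5.
by rewrite ler_wpM2l // divr_ge0 ?ler0n // ltW.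
Qed.

Lemma clean_weight : (10 * e <= #|G|)%N ->
  \sum_x lnmax1 R (mult F x) <= n / 2 * ln (58 / 10) + 5 * L3 * e%:R \/
  exists2 Bs : 5.-tuple {set G}, (forall i, F i \subset tnth Bs i)
    & two_char_config Bs \/ three_char_config Bs.
Proof.
move=> small_e.
have e0 : 0 <= 5 * L3 * e%:R by rewrite !mulr_ge0 ?ler0n // ltW.
have [/existsP[i0 small]|] := boolP [exists i, 5 * #|F i| <= 2 * #|G| + 5 * e]%N.
  (* One set has size at most [2n/5 + e], the other four at most [n/2], where [10e <= n] serves the
     small ones. The total is at most [2.4n + e]. *)
  left; have le2 i : (2 * #|F i| <= #|G|)%N.
    case: (leqP (5 * #|F i|) (2 * #|G| + 5 * e)) => [|big]; first by lia.
    have [B [oB B0 /subset_leq_card FB]] := large_clean_odd (@ovF i) big.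
    by rewrite -(card_odd_set oB B0) leq_mul2l.
  have sum_le : (10 * \sum_i #|F i| <= 24 * #|G| + 10 * e)%N.
    rewrite (bigD1 i0) //=.
    have : (\sum_(i < 5 | i != i0) 2 * #|F i| <= \sum_(i < 5 | i != i0) #|G|)%N.
      exact: leq_sum.
    rewrite -big_distrr sum_nat_const /= cardC1 card_ord; move: small; clear.
    by move: (\sum_(i < 5 | _) _)%N #|F i0| #|G| => s f m; lia.
    have h : (\sum_i #|F i|)%N%:R <= 24 / 10 * n + e%:R.
    move: sum_le; rewrite -(ler_nat R) natrD !natrM; lra.
  have := weight_le_sum h.
  (* A total of [2.4n] gives [3^(0.8n)], and this is at most [5.8^(n/2)] since [3^8 = 6561] while
     [5.8^5] exceeds 6563. *)
  have : 8 * L3 <= 5 * ln (58 / 10 : R).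
    have p58 : 0 < 58 / 10 :> R by lra.
    have -> : 8 * L3 = ln (3 ^+ 8) by rewrite lnXn ?ltr0n // mulr_natl.
    have -> : 5 * ln (58 / 10 : R) = ln ((58 / 10) ^+ 5).
      by rewrite lnXn // mulr_natl.
    rewrite ler_ln ?posrE ?exprn_gt0 ?ltr0n //; lra.
  move=> h3; have n0 : 0 <= n by rewrite ler0n.
  have h4 := ler_wpM2l n0 h3.
  have e1 : 0 <= L3 * e%:R by rewrite mulr_ge0 ?ler0n // ltW.
  move: h4 e1; lra.
rewrite negb_exists => /forallP big.
have /fin_all_exists[Bf BfP] i : exists B, [/\ odd_set B, B != set0 & F i \subset B].
  by apply: (large_clean_odd (@ovF i)); rewrite ltnNge big.
pose Bs := [tuple Bf i | i < 5].
have FBs i : F i \subset tnth Bs i by rewrite tnth_mktuple; case: (BfP i).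
have [| |h|h|h] := @odd_sets_weight Bs.
- by move=> B /tnthP[i ->]; rewrite tnth_mktuple; case: (BfP i).
- by apply/negP => /tnthP[i]; rewrite tnth_mktuple; case: (BfP i) => _ /eqP nz _ /esym.
- left; apply: (@le_trans _ _ (\sum_x lnmax1 R (mult (tnth Bs) x))).
    by apply: ler_sum => x _; apply/lnmax1_le/mult_mono.
  by apply: (le_trans h); rewrite lerDl.
- by right; exists Bs => //; left.
- by right; exists Bs => //; right.
Qed.

End FiveSets.

(** * Weights when the largest sum-free set is unique *)

Section UniqueLargest.
Variables (G : finZmodType) (R : realType).
Notation L2 := (ln (2%:R : R)).
Notation L3 := (ln (3%:R : R)).
Notation L5 := (ln (5%:R : R)).
Notation n := (#|G|%:R : R).
Variables (B : {set G}) (F : 'I_5 -> {set G}) (e : nat).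
Hypotheses (oB : odd_set B) (B0 : B != set0).
Hypothesis uniqB : forall C, odd_set C -> C != set0 -> C = B.
Hypothesis ovF : forall i, {in F i, forall a, overlap (F i) a <= e}%N.

Let J : {set 'I_5} := [set i | F i \subset B].

Let far i : i \notin J -> ~~ (F i \subset B).
Proof. by rewrite inE. Qed.

Let n0 : 0 <= n. Proof. exact: ler0n. Qed.
Let e0 : 0 <= e%:R :> R. Proof. exact: ler0n. Qed.

(** In the first case of [far_split], the left side is [beta] times the size of [F i] plus
    [alpha - beta] times its part outside [B], and both sizes are bounded. In the second,
    [alpha/4 + beta/10 <= (alpha + beta)/5] amounts to [alpha <= 2 * beta]. *)
Lemma far_weight i (alpha beta : R) : i \notin J ->
  0 <= beta -> beta <= alpha -> alpha <= 2 * beta ->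
  beta * #|F i :&: B|%:R + alpha * #|F i :\: B|%:R
    <= (alpha + beta) / 5 * n + alpha * e%:R.
Proof.
move=> /far FB b0 ba ab.
have hc := far_card uniqB (@ovF i) FB.
have hs := far_split oB B0 uniqB (@ovF i).
move: hc hs; rewrite -(cardsID B (F i)).
move: #|F i :&: B| #|F i :\: B| => y x hc hs.
have {}hc : 5 * (y%:R + x%:R) <= 2 * n + 5 * e%:R :> R.
  by move: hc; rewrite -(ler_nat R) natrM 2!natrD !natrM.
have a0 : 0 <= alpha by apply: le_trans ba.
have ab0 : 0 <= alpha - beta by rewrite subr_ge0.
have [h|[h1 h2]] := hs.
  have {}h : 5 * x%:R <= n + 5 * e%:R :> R by move: h; rewrite -(ler_nat R) natrD !natrM.
  have h3 := ler_wpM2l b0 hc; have h4 := ler_wpM2l ab0 h; lra.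
have {}h1 : 4 * x%:R <= n :> R by move: h1; rewrite -(ler_nat R) natrM.
have {}h2 : 10 * y%:R <= n :> R by move: h2; rewrite -(ler_nat R) natrM.
have h3 := ler_wpM2l a0 h1; have h4 := ler_wpM2l b0 h2.
have h5 : alpha * n <= 2 * beta * n by rewrite ler_wpM2r.
have h6 : 0 <= alpha * e%:R by rewrite mulr_ge0.
lra.
Qed.

(** A point in [m] of the sets not contained in [B] has multiplicity at most [#|J| + m] inside [B]
    and exactly [m] outside. Linear majorants of the logarithms split the sum over these sets, so
    that [far_weight] applies to each one. *)
Lemma unique_weight_interpolate (c alpha beta : R) :
  0 <= beta -> beta <= alpha -> alpha <= 2 * beta ->
  (forall m, (m <= 5 - #|J|)%N -> lnmax1 R (#|J| + m) <= c + beta * m%:R) ->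
  (forall m, (m <= 5 - #|J|)%N -> lnmax1 R m <= alpha * m%:R) ->
  \sum_x lnmax1 R (mult F x)
    <= c / 2 * n + (5 - #|J|)%N%:R * ((alpha + beta) / 5 * n + alpha * e%:R).
Proof.
move=> b0 ba ab hin hout.
pose m x := #|[set i | x \in F i] :\: J|.
have m_le x : (m x <= 5 - #|J|)%N.
  have := cardsC J; rewrite card_ord => h.
  have : (m x <= #|~: J|)%N by apply/subset_leq_card/subsetP=> i; rewrite !inE => /andP[].
  by move: h; clear; lia.
have mE x : (m x)%:R = \sum_(i | i \notin J) (x \in F i)%:R :> R.
  rewrite -natr_sum; congr _%:R; rewrite /m -sum1_card [RHS]big_mkcond [LHS]big_mkcond.
  by apply: eq_bigr => i _; rewrite !inE; case: (F i \subset B); case: (x \in F i).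
pose wt x : R := if x \in B then beta else alpha.
apply: (@le_trans _ _ (\sum_x (c * (x \in B)%:R
    + \sum_(i | i \notin J) wt x * (x \in F i)%:R))).
  apply: ler_sum => x _; rewrite -mulr_sumr -mE /wt.
  have multE : mult F x = (#|[set i | x \in F i] :&: J| + m x)%N by rewrite cardsID.
  have [xB|xB] := boolP (x \in B).
    rewrite mulr1; apply: le_trans (hin _ (m_le x)).
    by apply: lnmax1_le; rewrite multE leq_add2r subset_leq_card ?subsetIr.
  rewrite mulr0 add0r (_ : mult F x = m x) ?hout // multE.
  rewrite (_ : _ :&: J = set0) ?cards0 //; apply/setP=> i; rewrite !inE.
  by apply/negP => /andP[xF /subsetP/(_ x xF)]; rewrite (negbTE xB).
rewrite big_split /= -mulr_sumr -natr_sum -[X in c * X]/(_%:R).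
have -> : (\sum_x (x \in B))%N = #|B| by rewrite -sum1_card [RHS]big_mkcond.
have -> : c * #|B|%:R = c / 2 * n :> R.
  by rewrite -(card_odd_set oB B0) natrM; lra.
rewrite lerD2l exchange_big /=.
have cJ : (5 - #|J| = #|[predC J]|)%N.
  by have h := cardC (mem J); rewrite card_ord in h; rewrite -[RHS](addKn #|J|) h.
rewrite cJ mulr_natl -sumr_const; apply: ler_sum => i iJ.
apply: le_trans (far_weight iJ b0 ba ab).
rewrite -!sum1_card !natr_sum !mulr_sumr.
rewrite [leRHS](_ : _ = \sum_x (beta * (x \in F i :&: B)%:R + alpha * (x \in F i :\: B)%:R)).
  by apply: ler_sum => x _; rewrite /wt !inE; case: (x \in B); case: (x \in F i) => /=; lra.
rewrite big_split /=; congr (_ + _); rewrite big_mkcond /=; apply: eq_bigr => x _;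
by case: ifP; rewrite ?mulr1 ?mulr0.
Qed.

(** The main constant is the value reached for [#|J| = 3], namely [L3/2 + 2(5/2 * L2 - L3)/5]; the
    other cases stay below it. *)
Lemma unique_weight : (exists i, ~~ (F i \subset B)) ->
  \sum_x lnmax1 R (mult F x) <= (10 * L2 + L3) / 10 * n + 5 * L3 * e%:R.
Proof.
case=> i0 i0B.
have [[p2 h1 h2 h3] [[h4 h5 h6 h7] [f1 [f2 f3]]]] := ln_facts R.
have [[l0 l1 l2 l3 l4] l5] := lnmax1E R.
have L3e : 0 <= L3 * e%:R by rewrite mulr_ge0 //; lra.
have L2e : L2 * e%:R <= L3 * e%:R by rewrite ler_wpM2r //; lra.
have J4 : (#|J| <= 4)%N.
  have := cardsC J; rewrite card_ord; suff : (0 < #|~: J|)%N by clear; lia.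
  by apply/card_gt0P; exists i0; rewrite !inE.
have fn1 := ler_wpM2r n0 f1; have fn2 := ler_wpM2r n0 f2; have fn3 := ler_wpM2r n0 f3.
have [j1|j2] := leqP #|J| 1.
  (* At worst one set has size [n/2] and four have size [2n/5 + e]. *)
  have sum_le : (10 * \sum_i #|F i| <= 21 * #|G| + 50 * e)%N.
    have cJ : (#|J| + #|~: J| = 5)%N by rewrite cardsC card_ord.
    rewrite (bigID (mem J)) /=.
    have : (\sum_(i in J) 2 * #|F i| <= \sum_(i in J) #|G|)%N.
      by apply: leq_sum => i; rewrite inE -(card_odd_set oB B0) leq_mul2l => /subset_leq_card.
    have : (\sum_(i in ~: J) 5 * #|F i| <= \sum_(i in ~: J) (2 * #|G| + 5 * e))%N.
      by apply: leq_sum => i; rewrite inE => /far FB; apply: far_card uniqB (@ovF i) FB.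
    rewrite -!big_distrr !sum_nat_const /=.
    have -> : (\sum_(i in ~: J) #|F i| = \sum_(i | i \notin J) #|F i|)%N.
      by apply: eq_bigl => i; rewrite inE.
    move: j1 cJ; clear.
    move: (\sum_(i in J) _)%N (\sum_(i | _) _)%N #|J| #|~: J| #|G| => s t j k m.
    by case: j => [|[|//]] _; [rewrite add0n => ->|rewrite add1n => -[->]]; lia.
  have h : (\sum_i #|F i|)%N%:R <= 21 / 10 * n + 5 * e%:R.
    move: sum_le; rewrite -(ler_nat R) natrD !natrM; lra.
  have := weight_le_sum h; lra.
have := unique_weight_interpolate; case: #|J| J4 j2 => [|[|[|[|[|]]]]] // _ _ W.
(* Inside [B]: the line through [ln 3] at [m = 1] and [ln 4] at [m = 2]. Outside: the line through
   the origin and [ln 3] at [m = 3]. *)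
- have {}W := W (2 * L3 - 2 * L2) (L3 / 3) (2 * L2 - L3).
  have h8 : 0 <= 2 * L2 - L3 by lra.
  have h9 : 2 * L2 - L3 <= L3 / 3 by lra.
  have h10 : L3 / 3 <= 2 * (2 * L2 - L3) by lra.
  have {}W := W h8 h9 h10; apply: le_trans (W _ _) _; last by rewrite -[(5 - 2)%N]/3%N; lra.
  + by case=> [|[|[|[|//]]]] _; rewrite ?l0 ?l1 ?l2 ?l3 ?l4 ?l5; lra.
  + by case=> [|[|[|[|//]]]] _; rewrite ?l0 ?l1 ?l2 ?l3 ?l4 ?l5; lra.
(* Inside [B]: the line through [ln 3] at [m = 0] and [ln 4] at [m = 1]. Outside: the line through
   the origin and [ln 2] at [m = 2]. *)
- have {}W := W (L3) (L2 / 2) (2 * L2 - L3).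
  have h8 : 0 <= 2 * L2 - L3 by lra.
  have h9 : 2 * L2 - L3 <= L2 / 2 by lra.
  have h10 : L2 / 2 <= 2 * (2 * L2 - L3) by lra.
  have {}W := W h8 h9 h10; apply: le_trans (W _ _) _; last by rewrite -[(5 - 3)%N]/2%N; lra.
  + by case=> [|[|[|//]]] _; rewrite ?l0 ?l1 ?l2 ?l3 ?l4 ?l5; lra.
  + by case=> [|[|[|//]]] _; rewrite ?l0 ?l1 ?l2 ?l3 ?l4 ?l5; lra.
(* Here [m <= 1]: the line joins [ln 4] to [ln 5] inside [B], and outside the logarithm is 0, so
   [alpha] is taken as small as [beta] allows. *)
- have L5e : (L5 - 2 * L2) * e%:R <= L3 * e%:R by rewrite ler_wpM2r //; lra.
  have {}W := W (2 * L2) (L5 - 2 * L2) (L5 - 2 * L2).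
  have h8 : 0 <= L5 - 2 * L2 by lra.
  have h9 : L5 - 2 * L2 <= L5 - 2 * L2 by lra.
  have h10 : L5 - 2 * L2 <= 2 * (L5 - 2 * L2) by lra.
  have {}W := W h8 h9 h10; apply: le_trans (W _ _) _; last by rewrite -[(5 - 4)%N]/1%N; lra.
  + by case=> [|[|//]] _; rewrite ?l0 ?l1 ?l2 ?l3 ?l4 ?l5; lra.
  + by case=> [|[|//]] _; rewrite ?l0 ?l1 ?l2 ?l3 ?l4 ?l5; lra.
Qed.

End UniqueLargest.

Section UniqueLargestClean.
Variables (G : finZmodType) (R : realType).
Variables (B : {set G}) (F : 'I_5 -> {set G}) (e : nat).

Lemma unique_clean_weight :
  (forall C, largest_sum_free C -> C = B) ->
  (forall i, {in F i, forall a, overlap (F i) a <= e}%N) ->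
  (forall i, F i \subset B) \/
  \sum_x lnmax1 R (mult F x)
    <= (10 * ln 2%:R + ln 3%:R) / 10 * #|G|%:R + 5 * ln 3%:R * e%:R.
Proof.
move=> uniqL ovF.
have uniqB C : odd_set C -> C != set0 -> C = B by move=> oC C0; apply/uniqL/odd_set_largest.
have [/forallP allB|nB] := boolP [forall i, F i \subset B]; [by left|right].
have [/forallP small|] := boolP [forall i, 5 * #|F i| <= 2 * #|G| + 5 * e]%N.
  have [[p2 h1 h2 h3] [[h4 h5 h6 h7] [_ [_ f3]]]] := ln_facts R.
  have L3e : 0 <= ln 3%:R * e%:R :> R by rewrite mulr_ge0 ?ler0n //; lra.
  have n0 : 0 <= #|G|%:R :> R by rewrite ler0n.
  have sum_le : (\sum_i 5 * #|F i| <= \sum_(i < 5) (2 * #|G| + 5 * e))%N.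
    exact: leq_sum.
  have h : (\sum_i #|F i|)%N%:R <= 2 * #|G|%:R + 5 * e%:R :> R.
    move: sum_le; rewrite -big_distrr sum_nat_const card_ord leq_mul2l /=.
    by rewrite -(ler_nat R) natrD !natrM.
  have := weight_le_sum h; have := ler_wpM2r n0 f3.
  have L3n : 0 <= ln 3%:R * #|G|%:R :> R by rewrite mulr_ge0 //; lra.
  lra.
rewrite negb_forall => /existsP[i]; rewrite -ltnNge => big.
(* This is where [B] is seen to be odd: a large cleaned set yields a nonempty odd set, which is a
   largest sum-free set and so equals [B]. *)
have [C [oC C0 _]] := large_clean_odd (ovF i) big.
have CB := uniqB C oC C0; rewrite CB in oC C0.
move: nB; rewrite negb_forall => /existsP fB.
exact: unique_weight oC C0 uniqB ovF fB.
Qed.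

End UniqueLargestClean.

(** * From containers to colorings *)

Lemma ln_powR_small (R : realType) (eps : R) : 0 < eps ->
  exists n0 : nat, forall n : nat, (n0 <= n)%N ->
    1 <= ln (n%:R : R) /\ ln (n%:R : R) `^ (- (1 / 27)) <= eps.
Proof.
move=> eps0; pose M : R := 1 + eps^-1 ^+ 27.
have i0 : 0 <= eps^-1 by rewrite invr_ge0 ltW.
have M1 : 1 <= M by rewrite lerDl exprn_ge0.
exists (Num.truncn (expR M)).+1 => n len.
have ltn : expR M < n%:R.
  have /andP[_ h] := truncn_itv (expR_ge0 M).
  by apply: lt_le_trans h _; rewrite ler_nat.
have lnM : M <= ln n%:R.
  by rewrite -[M]expRK ler_ln ?posrE ?expR_gt0 ?ltW // (lt_trans (expR_gt0 M)).
split; first exact: le_trans lnM.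
rewrite powRN -[eps]invrK lef_pV2 ?posrE ?invr_gt0 ?powR_gt0 //; last first.
  by apply: lt_le_trans lnM; apply: lt_le_trans M1.
have -> : eps^-1 = (eps^-1 ^+ 27) `^ (1 / 27).
  rewrite -powR_mulrn // -powRrM (_ : 27%:R * (1 / 27) = 1) ?powRr1 //.
  by rewrite mul1r divff // pnatr_eq0.
rewrite ge0_ler_powR ?nnegrE ?exprn_ge0 ?divr_ge0 //.
  by apply: le_trans lnM; apply: le_trans M1.
by apply: le_trans lnM; rewrite lerDr.
Qed.

(** The existential keeps the numeral opaque later on. The gap holds because [2^10 * 3 = 3072] is
    below [4.99^5], about 3093.9. *)
Lemma ln_gap4999 (R : realType) : exists2 x : R,
  (forall k, (4999 / 1000) ^+ k = x ^+ k)
  & 0 < x /\ 10 * ln 2%:R + ln 3%:R < 5 * ln x.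
Proof.
exists (4999 / 1000) => //; set x : R := 4999 / 1000.
have x_gt : 499 / 100 < x by rewrite /x; lra.
have x0 : 0 < x by apply: lt_trans x_gt; lra.
clearbody x; split=> //; have -> : 10 * ln 2%:R + ln 3%:R = ln (2%:R ^+ 10 * 3%:R : R).
  by rewrite lnM ?posrE ?exprn_gt0 ?ltr0n // lnXn ?ltr0n // mulr_natl.
have -> : 5 * ln x = ln (x ^+ 5) by rewrite lnXn // [LHS]mulr_natl.
rewrite ltr_ln ?posrE ?mulr_gt0 ?exprn_gt0 ?ltr0n //.
apply: (@lt_trans _ _ ((499 / 100) ^+ 5)); first by lra.
by rewrite ltrXn2r //; lra.
Qed.

Section Containers.
Variables (R : realType) (G : finZmodType).
Implicit Types (A B F : {set G}) (FF : {set {set G}}).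
Notation n := (#|G|%:R : R).
Notation L2 := (ln (2%:R : R)).
Notation L3 := (ln (3%:R : R)).
Notation L5 := (ln (5%:R : R)).

(** With threshold about [d * n], [card_clean] leaves at most [n^2 d^3 / (d n)] discarded
    elements. *)
Lemma card_clean_le (d : R) F : 0 < d ->
  #|schur_triples F|%:R <= n ^+ 2 * d ^+ 3 ->
  #|F :\: clean (Num.truncn (d * n)) F|%:R <= d ^+ 2 * n.
Proof.
move=> d0 hF; set e := Num.truncn (d * n).
have n0 : 0 < n.
  by rewrite ltr0n; apply/card_gt0P; exists 0.
have dn0 : 0 < d * n by rewrite mulr_gt0.
have /andP[_ he] := truncn_itv (ltW dn0).
rewrite -(ler_pM2l dn0); apply: (@le_trans _ _ (n ^+ 2 * d ^+ 3)); last first.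
  by rewrite le_eqVlt; apply/orP; left; apply/eqP; ring.
apply: le_trans hF; apply: (@le_trans _ _ (e.+1%:R * #|F :\: clean e F|%:R)).
  by rewrite ler_wpM2r ?ler0n // ltW.
by rewrite -natrM ler_nat card_clean.
Qed.

(** Pigeonhole over the [#|FF| ^ r] tuples of containers. *)
Lemma popular_containers A FF (r : nat) (g : coloring r A -> r.-tuple {set G}) (X : R) :
  container_assignment FF g -> 0 <= X -> X < (kappa r A)%:R ->
  exists2 Fs : r.-tuple {set G}, (forall i, tnth Fs i \in FF)
    & X < #|assigned_colorings g Fs|%:R * #|FF|%:R ^+ r.
Proof.
move=> gP X0 Xk.
pose S (f : {ffun 'I_r -> {set G}}) := assigned_colorings g [tuple f i | i < r].
have [/existsP[f /andP[fF fX]]|] :=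
  boolP [exists f : {ffun 'I_r -> {set G}},
    (f \in ffun_on (mem FF)) && (X < #|S f|%:R * #|FF|%:R ^+ r)].
  exists [tuple f i | i < r] => // i; rewrite tnth_mktuple.
  exact: (ffun_onP fF).
rewrite negb_exists => /forallP none; exfalso.
have kE : (kappa r A <= \sum_(f in ffun_on (mem FF)) #|S f|)%N.
  rewrite /kappa -sum1_card.
  rewrite (partition_big (fun phi => [ffun i => tnth (g phi) i]) (mem (ffun_on (mem FF)))) /=.
    apply: leq_sum => f _; rewrite sum1dep_card.
    apply/subset_leq_card/subsetP=> phi; rewrite !inE => /andP[-> /eqP fE] /=.
    by apply/eqP/eq_from_tnth => i; rewrite tnth_mktuple -fE ffunE.
  move=> phi sphi; apply/ffun_onP => i; rewrite ffunE.
  by have [] := gP phi sphi i.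
have N0 : (0 < #|FF| ^ r)%N.
  have k0 : (0 < kappa r A)%N by rewrite -(ltr0n R) (le_lt_trans X0).
  have [phi sphi] := card_gt0P k0; rewrite expn_gt0; apply/orP.
  case: (posnP r) => [_|r0]; first by right.
  left; apply/card_gt0P; exists (tnth (g phi) (Ordinal r0)).
  by have [] := gP phi sphi (Ordinal r0).
have N0' : 0 < #|FF|%:R ^+ r :> R by rewrite -natrX ltr0n.
have : (kappa r A)%:R * #|FF|%:R ^+ r <= #|FF|%:R ^+ r * X.
  have -> : #|FF|%:R ^+ r * X = \sum_(f in ffun_on (mem FF) : {pred {ffun 'I_r -> {set G}}}) X.
    by rewrite sumr_const card_ffun_on card_ord -natrX mulr_natl.
  apply: (@le_trans _ _ ((\sum_(f in ffun_on (mem FF)) #|S f|)%N%:R * #|FF|%:R ^+ r)).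
    by rewrite ler_wpM2r ?ler_nat // ltW.
  rewrite natr_sum mulr_suml; apply: ler_sum => f fF.
  by have := none f; rewrite fF /= -leNgt.
by rewrite mulrC ler_pM2l // leNgt Xk.
Qed.

Lemma clean_assigned_weight A FF (g : coloring 5 A -> 5.-tuple {set G})
    (Fs : 5.-tuple {set G}) (d : R) :
  0 < d -> d <= 1 ->
  (forall F, F \in FF -> #|schur_triples F|%:R <= n ^+ 2 * d ^+ 3) ->
  container_assignment FF g -> (forall i, tnth Fs i \in FF) ->
  (0 < #|assigned_colorings g Fs|)%N ->
  ln (#|assigned_colorings g Fs|%:R : R) <= 5 * L5 * (d * n) +
    \sum_x lnmax1 R (mult (fun i => clean (Num.truncn (d * n)) (tnth Fs i)) x).
Proof.
move=> d0 d1 hFF gP FsF h0.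
have := ln_card_assigned R (fun i => clean (Num.truncn (d * n)) (tnth Fs i)) gP h0.
move=> /le_trans; apply; rewrite lerD2r -[leRHS]mulrA [leRHS]mulrCA.
have p5 : 0 <= L5 by rewrite ln_ge0 // ler1n.
rewrite ler_wpM2l //.
have n0 : 0 <= n by rewrite ler0n.
have -> : 5 * (d * n) = \sum_(i < 5) d * n by rewrite sumr_const card_ord mulr_natl.
apply: ler_sum => i _; apply: le_trans (card_clean_le d0 (hFF _ (FsF i))) _.
by rewrite expr2 -mulrA ler_piMl // mulr_ge0 // ltW.
Qed.

End Containers.

Theorem theorem2p6 (R : realType) :
  exists n0 : nat, forall (G : finZmodType),
  let n : R := #|G|%:R in
  let delta : R := ln n `^ (- (1 / 27)) in
  ~~ odd #|G| -> (n0 <= #|G|)%N ->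
  forall (A : {set G}) (FF : {set {set G}})
         (g : coloring 5 A -> 5.-tuple {set G}),
  container_family R A FF -> container_assignment FF g ->
  (forall B : {set G},
     largest_sum_free B -> (forall C, largest_sum_free C -> C = B) ->
     (4999 / 1000) ^+ (#|G| %/ 2) < (kappa 5 A)%:R :> R ->
     #|A :\: B|%:R < 15 * n * delta)
  /\
  ((2 <= #|[set B : {set G} | largest_sum_free B]|)%N ->
   forall Fs : 5.-tuple {set G},
   (forall i, tnth Fs i \in FF) ->
   (59 / 10) ^+ (#|G| %/ 2) < #|assigned_colorings g Fs|%:R :> R ->
   exists B1 B2 B3 : {set G},
     [/\ largest_sum_free B1, largest_sum_free B2 & largest_sum_free B3] /\
     ( (B3 = symdiff B1 B2 /\
        exists f : 'I_5 -> 'I_3,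
          let Bf := [tuple tnth [tuple B1; B2; B3] (f i) | i < 5] in
          (forall i, #|tnth Fs i :\: tnth Bf i|%:R < 3 * n * delta) /\
          consists_of Bf [:: 4; 3; 3]%N)
     \/
       (exists B4 B5 B6 B7 : {set G},
          [/\ uniq [:: B4; B5; B6; B7],
              all (@largest_sum_free G) [:: B4; B5; B6; B7],
              all (fun B : {set G} => B \subset B1 :|: B2 :|: B3)
                  [:: B4; B5; B6; B7]
            & exists f : 'I_5 -> 'I_7,
              let Bf :=
                [tuple tnth [tuple B1; B2; B3; B4; B5; B6; B7] (f i) | i < 5] in
              (forall i, #|tnth Fs i :\: tnth Bf i|%:R < 3 * n * delta) /\
              consists_of Bf [:: 2; 2; 3; 3; 3; 3; 4]%N]))).
Proof.
pose L2 := ln (2%:R : R); pose L3 := ln (3%:R : R); pose L5 := ln (5%:R : R).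
pose U := ln (59 / 10 : R); pose W := ln (58 / 10 : R).
have p2 : 0 < L2 by rewrite ln_gt0 // ltr1n.
have p3 : 0 < L3 by rewrite ln_gt0 // ltr1n.
have p5 : 0 < L5 by rewrite ln_gt0 // ltr1n.
have [x xE [x0 x_gap]] := ln_gap4999 R.
pose T := ln x; have gapT : 10 * L2 + L3 < 5 * T := x_gap.
have W0 : 0 < 58 / 10 :> R by clear; lra.
have U0 : 0 < 59 / 10 :> R by clear; lra.
have gapU : W < U by rewrite ltr_ln ?posrE //; clear; lra.
(* In units of [delta * n], the errors are [5 * L2] from the number of container tuples, [5 * L3]
   from the terms in [e], and [5 * L5] from cleaning. *)
pose D := 5 * L2 + 5 * L3 + 5 * L5.
have D0 : 0 < D by rewrite /D !addr_gt0 // mulr_gt0 // ltr0n.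
(* The two gaps per group element: [(ln 4.999)/2] against the constant of [unique_clean_weight], and
   [(ln 5.9)/2] against [(ln 5.8)/2]. *)
pose gamma := Num.min ((5 * T - (10 * L2 + L3)) / 10) ((U - W) / 2).
have gamma0 : 0 < gamma.
  by rewrite lt_min !divr_gt0 ?subr_gt0.
have [gamma1 gamma2] : gamma <= (5 * T - (10 * L2 + L3)) / 10 /\ gamma <= (U - W) / 2.
  by rewrite /gamma !ge_min !lexx ?orbT.
(* The bound [gamma / D] keeps the errors within the gaps, and [1 / 10] ensures [10e <= n]. *)
have eps0 : 0 < Num.min (gamma / D) (1 / 10).
  by rewrite lt_min !divr_gt0 // ltr0n.
have [n0 n0P] := ln_powR_small eps0.
exists n0 => G n delta evenG leG A FF g [_ FFcard _ FFschur] gP.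
have [ln1 d_small] := n0P _ leG.
have d0 : 0 < delta by rewrite powR_gt0 // (lt_le_trans ltr01).
have [dD d10] : delta <= gamma / D /\ delta <= 1 / 10.
  by move: d_small; rewrite le_min => /andP[].
have d1 : delta <= 1 by apply: le_trans d10 _; clear; lra.
have {}dD : D * delta <= gamma by rewrite mulrC -ler_pdivlMr.
have npos : 0 < n by rewrite ltr0n; apply/card_gt0P; exists 0.
have d18 : ln n `^ (- (1 / 18)) <= delta by apply: ler_powR => //; clear; lra.
have d3 : ln n `^ (- (1 / 9)) = delta ^+ 3.
  rewrite -powR_mulrn ?powR_ge0 // -powRrM; congr (_ `^ _).
  by clear; lra.
have schurF F : F \in FF -> #|schur_triples F|%:R <= n ^+ 2 * delta ^+ 3.
  by rewrite -d3; apply: FFschur.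
set e := Num.truncn (delta * n).
have dn0 : 0 < delta * n by rewrite mulr_gt0.
have eP : e%:R <= delta * n by have /andP[] := truncn_itv (ltW dn0).
have e10 : (10 * e <= #|G|)%N.
  have hh : delta * n <= 1 / 10 * n by rewrite ler_wpM2r // ltW.
  by rewrite -(ler_nat R) natrM -/n; move: hh eP; clear; lra.
have dDn : D * (delta * n) <= gamma * n by rewrite mulrA ler_wpM2r // ltW.
have L3e : L3 * e%:R <= L3 * (delta * n) by rewrite ler_wpM2l // ltW.
have half y : 0 < y -> ln (y ^+ (#|G| %/ 2) : R) = n / 2 * ln y.
  move=> y0; rewrite lnXn // -[LHS]mulr_natl; congr (_ * _).
  have -> : n = (2 * (#|G| %/ 2))%N%:R :> R.
    by congr _%:R; rewrite mulnC divn2 muln2 -[LHS]odd_double_half (negbTE evenG).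
  by rewrite natrM; clear; lra.
have dirt Fs (Bs : 'I_5 -> {set G}) i : (forall i, tnth Fs i \in FF) ->
    clean e (tnth Fs i) \subset Bs i -> #|tnth Fs i :\: Bs i|%:R < 3 * n * delta.
  move=> FsF sub; apply: (@le_lt_trans _ _ (delta ^+ 2 * n)).
    apply: le_trans (card_clean_le d0 (schurF _ (FsF i))).
    by rewrite ler_nat subset_leq_card // setDS.
  have : delta ^+ 2 * n <= delta * n.
    by rewrite expr2 ler_wpM2r ?(ltW npos) // ler_piMl // ltW.
  by move: dn0; clear; lra.
have cleanF (Fs : 5.-tuple {set G}) i :
    {in clean e (tnth Fs i), forall a, overlap (clean e (tnth Fs i)) a <= e}%N.
  exact: clean_overlap.
split.
  move=> B largeB uniqB; rewrite xE => kbig.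
  have [Fs FsF big] := popular_containers gP (exprn_ge0 _ (ltW x0)) kbig.
  have Phi0 : (0 < #|assigned_colorings g Fs|)%N.
    rewrite lt0n; apply: contraTneq big => ->.
    by rewrite mul0r -leNgt exprn_ge0 // ltW.
  have FF0 : (0 < #|FF|)%N by apply/card_gt0P; exists (tnth Fs ord0).
  have lnbig : n / 2 * T < ln #|assigned_colorings g Fs|%:R + 5 * ln #|FF|%:R.
    have -> : 5 * ln #|FF|%:R = ln (#|FF|%:R ^+ 5) :> R.
      by rewrite lnXn ?ltr0n // [LHS]mulr_natl.
    rewrite -half // -lnM ?posrE ?exprn_gt0 ?ltr0n //.
    by rewrite ltr_ln ?posrE ?mulr_gt0 ?exprn_gt0 ?ltr0n.
  have lnFF : ln #|FF|%:R <= L2 * (delta * n).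
    move: FFcard; rewrite ler_pdivrMr // => /le_trans; apply.
    rewrite mulrC ler_wpM2l ?(ltW p2) // mulrC ler_wpM2r // ltW //.
  (* If all cleaned containers lie in [B], the containers still cover [A], so [A :\: B] is covered
     by five sets [tnth Fs i :\: B], each smaller than [3 * n * delta]. Otherwise the weight bound
     contradicts [lnbig]. *)
  have [allB|weight] := unique_clean_weight R uniqB (cleanF Fs).
    have cov := assigned_cover gP Phi0.
    have : (#|A :\: B| <= \sum_i #|tnth Fs i :\: B|)%N.
      rewrite -sum_mult -sum1_card big_mkcond; apply: leq_sum => y _.
      case: ifP => // /setDP[/(subsetP cov)/bigcupP[i _ yF] yB].
      by apply/card_gt0P; exists i; rewrite !inE yF yB.
    rewrite -(ler_nat R) natr_sum => /le_lt_trans; apply.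
    have -> : 15 * n * delta = \sum_(i < 5) 3 * n * delta.
      by rewrite sumr_const card_ord -mulr_natl; clear; lra.
    apply: ltr_sum; first by apply/hasP; exists ord0; rewrite ?mem_index_enum.
    by move=> i _; apply: (dirt Fs (fun=> B)).
  have := clean_assigned_weight d0 d1 schurF gP FsF Phi0.
  have g1n : gamma * n <= (5 * T - (10 * L2 + L3)) / 10 * n by rewrite ler_wpM2r // ltW.
  move: weight; rewrite -/e -/L3 -/L2 -/L5 -/n; rewrite /D in dDn.
  by move: dDn lnFF lnbig L3e g1n; clear; lra.
move=> _ Fs FsF big.
have Phi0 : (0 < #|assigned_colorings g Fs|)%N.
  by rewrite -(ltr0n R); apply: le_lt_trans big; rewrite exprn_ge0 // ltW.
have lnbig : n / 2 * U < ln #|assigned_colorings g Fs|%:R.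
  by rewrite -half // ltr_ln ?posrE ?exprn_gt0 ?ltr0n.
have [weight|[Bs sub config]] := clean_weight R (cleanF Fs) e10.
  exfalso; have := clean_assigned_weight d0 d1 schurF gP FsF Phi0.
  have g2n : gamma * n <= (U - W) / 2 * n by rewrite ler_wpM2r // ltW.
  have L2dn : 0 <= L2 * (delta * n) by rewrite mulr_ge0 ?ltW.
  move: weight; rewrite -/e -/L3 -/L5 -/n -/W; rewrite /D in dDn.
  by move: dDn lnbig L3e g2n L2dn; clear; lra.
case: config => [[B1 [B2 [large [[f fE] cons]]]]|].
  exists B1, B2, (symdiff B1 B2); split=> //; left; split=> //; exists f.
  by rewrite fE; split=> // i; apply: dirt.
case=> B1 [B2 [B3 [large [[B4 [B5 [B6 [B7 [u4 l4 s4 [f fE]]]]]] cons]]]].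
exists B1, B2, B3; split=> //; right; exists B4, B5, B6, B7; split=> //; exists f.
by rewrite fE; split=> // i; apply: dirt.
Qed.
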